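(* Let $\mathbf A\in\mathbb R^{m\times m}$ be a symmetric positive semidefinite matrix of rank $r_A$ with largest singular value $\sigma_1(\mathbf A)=1$ and smallest nonzero singular value $\sigma_{r_A}(\mathbf A)=1/\kappa$, where $\kappa>1$. Consider solving the matrix factorization problem $$\min_{\mathbf X\in\mathsf{St}(m,r),\,\mathbf\Theta\in\mathbb S^r} f(\mathbf X,\mathbf\Theta):=\tfrac14\|\mathbf X\mathbf\Theta\mathbf X^\top-\mathbf A\|_{\mathsf F}^2$$ initialized with a random $\mathbf X_0\in\mathsf{St}(m,r)$, $r>r_A$. Suppose that $r_A\le\frac m2$. Overparameterized DMD (defined in the context) using stepsizes $\eta=\mathcal O\big(\frac{(r-r_A)^2}{m r r_A\kappa}\big)$ and $\mu=2$ generates a sequence $\{\mathbf X_t,\mathbf\Theta_t\}_{t=0}^\infty$. With high probability over the initialization, this sequence satisfies that for any $\varepsilon\in(0,1)$, $f(\mathbf X_{t_\varepsilon},\mathbf\Theta_{t_\varepsilon})\le\varepsilon$ after at most $$t_\varepsilon=\mathcal O\Big(\frac{m^2r^2r_A^2\kappa^2}{(r-r_A)^4}+\frac{m r r_A\kappa^2}{(r-r_A)^2}\log\big(\tfrac1\varepsilon\big)\Big)$$ iterations.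
   Context: $\mathsf{St}(m,r)=\{\mathbf X\in\mathbb R^{m\times r}:\mathbf X^\top\mathbf X=\mathbf I_r\}$ is the Stiefel manifold, $\mathbb S^r$ is the set of symmetric $r\times r$ matrices, and $\|\cdot\|_{\mathsf F}$ is the Frobenius norm. Random initialization means that $\mathbf X_0$ is drawn uniformly at random from $\mathsf{St}(m,r)$, e.g. as $\mathbf X_0=\mathbf Z_0(\mathbf Z_0^\top\mathbf Z_0)^{-1/2}$, where $\mathbf Z_0\in\mathbb R^{m\times r}$ has i.i.d. $\mathcal N(0,1)$ entries. Overparameterized DMD (direction–magnitude decomposition) with stepsizes $\eta,\mu>0$: for $t=0,1,2,\dots$, (i) $\mathbf\Theta_t=(1-\frac\mu2)\mathbf\Theta_{t-1}+\frac\mu2\mathbf X_t^\top\mathbf A\mathbf X_t$ (so for $\mu=2$, $\mathbf\Theta_t=\mathbf X_t^\top\mathbf A\mathbf X_t$); (ii) with $\hat{\mathbf G}_t=(\mathbf X_t\mathbf X_t^\top-\mathbf A)\mathbf X_t$, set $\mathbf G_t=(\mathbf I_m-\mathbf X_t\mathbf X_t^\top)\hat{\mathbf G}_t+\frac12\mathbf X_t(\mathbf X_t^\top\hat{\mathbf G}_t-\hat{\mathbf G}_t^\top\mathbf X_t)$; (iii) $\mathbf X_{t+1}=(\mathbf X_t-\eta\mathbf G_t)(\mathbf I_r+\eta^2\mathbf G_t^\top\mathbf G_t)^{-1/2}$. *)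

(* Defs.v *)
From HB Require Import structures.
From mathcomp Require Import all_boot all_order all_algebra.
From mathcomp Require Import all_classical all_reals all_analysis.

Set Implicit Arguments.
Unset Strict Implicit.
Unset Printing Implicit Defensive.

Import Order.TTheory GRing.Theory Num.Theory.
Import numFieldNormedType.Exports.
Local Open Scope classical_set_scope.
Local Open Scope ring_scope.

Section Matrices.
Context {R : realType}.

Definition psd_sym n (A : 'M[R]_n) : Prop :=
  A^T = A /\ forall x : 'cV[R]_n, 0 <= (x^T *m A *m x) 0 0.

Definition singular_value m n (A : 'M[R]_(m, n)) (s : R) : Prop :=
  0 <= s /\ eigenvalue (A^T *m A) (s ^+ 2).

Definition largest_singular_value m n (A : 'M[R]_(m, n)) (s : R) : Prop :=
  singular_value A s /\ forall s', singular_value A s' -> s' <= s.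

Definition smallest_nonzero_singular_value m n (A : 'M[R]_(m, n)) (s : R) :
    Prop :=
  [/\ singular_value A s, s != 0
    & forall s', singular_value A s' -> s' != 0 -> s <= s'].

Definition frobenius m n (A : 'M[R]_(m, n)) : R :=
  Num.sqrt (\sum_i \sum_j A i j ^+ 2).

(* The inverse square root M^(-1/2) of a symmetric positive definite M: the
   unique symmetric positive semidefinite B with B^2 = M^-1.  The default
   value 0 is only taken for matrices M having no such B. *)
Definition invsqrtmx n (M : 'M[R]_n) : 'M[R]_n :=
  xget 0 [set B : 'M[R]_n | psd_sym B /\ B *m B *m M = 1%:M].

Definition stiefel m r : set 'M[R]_(m, r) := [set X | X^T *m X = 1%:M].

Definition borel_mx m r : set (set 'M[R]_(m, r)) :=
  <<s [set U : set 'M[R]_(m, r) | open U] >>.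

End Matrices.

Arguments stiefel {R} m r.
Arguments borel_mx {R} m r.

(* The uniform distribution on St(m, r) is the only probability measure on it
   that is invariant under all rotations X |-> Q X with Q in O(m); it is the law
   of Z (Z^T Z)^(-1/2) for Z with i.i.d. standard Gaussian entries. *)
Definition uniform_on_stiefel (R : realType) (d : measure_display)
    (T : measurableType d) (P : probability T R) (m r : nat)
    (X : T -> 'M[R]_(m, r)) : Prop :=
  [/\ forall w, stiefel m r (X w),
      forall B, borel_mx m r B -> measurable (X @^-1` B)
    & forall Q : 'M[R]_m, Q^T *m Q = 1%:M ->
        forall B, borel_mx m r B ->
          P ((fun w => Q *m X w) @^-1` B) = P (X @^-1` B)].

Section DMD.
Context {R : realType} {m r : nat}.
Variable A : 'M[R]_m.

Definition objective (X : 'M[R]_(m, r)) (Theta : 'M[R]_r) : R :=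
  4%:R^-1 * frobenius (X *m Theta *m X^T - A) ^+ 2.

Definition dmd_grad (X : 'M[R]_(m, r)) : 'M[R]_(m, r) :=
  let Gh := (X *m X^T - A) *m X in
  (1%:M - X *m X^T) *m Gh + 2%:R^-1 *: (X *m (X^T *m Gh - Gh^T *m X)).

Definition dmd_step (eta : R) (X : 'M[R]_(m, r)) : 'M[R]_(m, r) :=
  let G := dmd_grad X in
  (X - eta *: G) *m invsqrtmx (1%:M + eta ^+ 2 *: (G^T *m G)).

Definition dmd_X (eta : R) (X0 : 'M[R]_(m, r)) (t : nat) : 'M[R]_(m, r) :=
  iter t (dmd_step eta) X0.

(* [Theta_init] plays the role of Theta_(-1); it has no influence when
   [mu = 2]. *)
Fixpoint dmd_Theta (eta mu : R) (X0 : 'M[R]_(m, r)) (Theta_init : 'M[R]_r)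
    (t : nat) : 'M[R]_r :=
  let Xt := dmd_X eta X0 t in
  let Theta_prev :=
    if t is t'.+1 then dmd_Theta eta mu X0 Theta_init t' else Theta_init in
  (1 - mu / 2%:R) *: Theta_prev + (mu / 2%:R) *: (Xt^T *m A *m Xt).

End DMD.

(* Main.v *)
Require Import Defs.
From HB Require Import structures.
From mathcomp Require Import all_boot all_order all_algebra.
From mathcomp Require Import all_classical all_reals all_analysis.
From mathcomp Require Import measurable_realfun complex ring lra.

Set Implicit Arguments.
Unset Strict Implicit.
Unset Printing Implicit Defensive.

Import Order.TTheory GRing.Theory Num.Theory.
Import numFieldNormedType.Exports.
Local Open Scope classical_set_scope.
Local Open Scope ring_scope.

(* Write A = U L U^T with U^T U = 1 and L diagonal with entries in [1/kappa, 1].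
   On the Stiefel manifold the gradient is -(1 - X X^T) A X.  If N is a right
   inverse of U^T X, the matrix T = (1 - U U^T) X N is the tangent of the angle
   between range A and range X, and one step of the method maps T to exactly
   T (1 + eta H^-1)^-1, where H = L^-1 - eta (U^T X)(U^T X)^T lies between 0 and
   kappa.  So |T|_F^2 contracts by (1 + eta / kappa)^-2 for every eta < 1, from
   any initial point with U^T X of full rank, and the objective is at most
   |T|_F^2 / 2.  As the number of iterations depends only logarithmically on
   the initial |T|_F^2 <= r_A / det ((U^T X)(U^T X)^T), it is enough that this
   determinant exceeds exp (- K r_A m / (r - r_A)) with high probability.

   The determinant is a product of r_A ratios of consecutive Gram determinants.
   By rotation invariance, the law of X is unchanged by reflections that move the
   last column of U to a direction g / |g|, and such a ratio then becomes
   g^T S g / |g|^2 with S an orthogonal projection of rank > r - r_A.  Averaging over a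
   finite grid of vectors g, a pivoted Cholesky elimination bounds the Laplace
   transform of g^T S g, one coordinate of g at a time. *)

(** * Squared Frobenius norm and real spectral theorem *)

Section SquaredNorm.
Context {R : realFieldType}.

Definition normsq m n (X : 'M[R]_(m, n)) : R := \tr (X^T *m X).

Lemma normsqE m n (X : 'M[R]_(m, n)) : normsq X = \sum_i \sum_j X i j ^+ 2.
Proof.
rewrite /normsq /mxtrace exchange_big /=; apply: eq_bigr => j _.
by rewrite mxE; apply: eq_bigr => i _; rewrite mxE expr2.
Qed.

Lemma normsq_tr m n (X : 'M[R]_(m, n)) : normsq X^T = normsq X.
Proof. by rewrite /normsq trmxK mxtrace_mulC. Qed.

Lemma normsq_ge0 m n (X : 'M[R]_(m, n)) : 0 <= normsq X.
Proof.
by rewrite normsqE; apply: sumr_ge0 => i _; apply: sumr_ge0 => j _; exact: sqr_ge0.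
Qed.

Lemma normsq_eq0 m n (X : 'M[R]_(m, n)) : normsq X = 0 -> X = 0.
Proof.
rewrite normsqE => /eqP; rewrite psumr_eq0; last first.
  by move=> i _; apply: sumr_ge0 => j _; exact: sqr_ge0.
move=> /allP H; apply/matrixP => i j; rewrite mxE.
have /eqP /eqP := H i (mem_index_enum _); rewrite psumr_eq0; last first.
  by move=> k _; exact: sqr_ge0.
move=> /allP /(_ j (mem_index_enum _)) /=.
by rewrite sqrf_eq0 => /eqP.
Qed.

Lemma normsq_rows m n (X : 'M[R]_(m, n)) : normsq X = \sum_i normsq (row i X).
Proof.
rewrite normsqE; apply: eq_bigr => i _.
rewrite normsqE big_ord_recl big_ord0 addr0.
by apply: eq_bigr => j _; rewrite mxE.
Qed.

Lemma normsqN m n (X : 'M[R]_(m, n)) : normsq (- X) = normsq X.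
Proof. by rewrite /normsq [(- X)^T]linearN /= mulmxN mulNmx opprK. Qed.

Lemma normsqZ m n a (X : 'M[R]_(m, n)) : normsq (a *: X) = a ^+ 2 * normsq X.
Proof.
by rewrite /normsq [(a *: X)^T]linearZ /= -scalemxAl -scalemxAr scalerA -expr2 linearZ.
Qed.

Lemma normsqD_orth m n (X Y : 'M[R]_(m, n)) :
  X^T *m Y = 0 -> normsq (X + Y) = normsq X + normsq Y.
Proof.
move=> XY; have YX : Y^T *m X = 0 by rewrite -[X]trmxK -trmx_mul XY trmx0.
by rewrite /normsq [(X + Y)^T]linearD /= mulmxDl !mulmxDr XY YX addr0 add0r linearD.
Qed.

Lemma isometry_normsq m r p (X : 'M[R]_(m, r)) (Y : 'M[R]_(r, p)) :
  X^T *m X = 1%:M -> normsq (X *m Y) = normsq Y.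
Proof. by move=> XX; rewrite /normsq trmx_mul -mulmxA (mulmxA X^T) XX mul1mx. Qed.

End SquaredNorm.

Section RealSpectral.
Context {R : rcfType}.

Lemma mx11_trace (M : 'M[R]_1) : M = (\tr M)%:M.
Proof. by rewrite {1}[M]mx11_scalar /mxtrace big_ord_recl big_ord0 addr0. Qed.

(** A complex eigenvector x + i y with eigenvalue a + i b exists. Computing x A y^T in two ways
    gives b (|x|^2 + |y|^2) = 0, so b = 0 and whichever of x, y is nonzero is a real eigenvector. *)
Lemma symmetric_eigen n (A : 'M[R]_n.+1) : A^T = A ->
  exists a (v : 'cV[R]_n.+1), A *m v = a *: v /\ normsq v = 1.
Proof.
move=> As.
suff [a [v [Av v0]]] : exists a (v : 'rV[R]_n.+1), v *m A = a *: v /\ v != 0.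
  have nv : 0 < normsq v.
    by rewrite lt0r normsq_ge0 andbT; apply: contra v0 => /eqP/normsq_eq0 ->.
  exists a, ((Num.sqrt (normsq v))^-1 *: v^T); split.
    by rewrite -scalemxAr -As -trmx_mul Av linearZ /= scalerA mulrC -scalerA.
  by rewrite normsqZ normsq_tr exprVn sqr_sqrtr ?normsq_ge0 // mulVf ?gt_eqF.
pose f : {rmorphism R -> R[i]} := real_complex R.
have [c /eigenvalueP [v vA v0]] := eigenvalue_closed (map_mx f A) (ltn0Sn n).
pose x : 'rV[R]_n.+1 := map_mx (@complex.Re R) v; pose y : 'rV[R]_n.+1 := map_mx (@complex.Im R) v.
pose a := complex.Re c; pose b := complex.Im c.
have xA : x *m A = a *: x - b *: y.
  apply/rowP => j; have /rowP/(_ j) := vA; rewrite !mxE => e.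
  have -> : \sum_i x 0 i * A i j = complex.Re (\sum_i v 0 i * map_mx f A i j).
    rewrite raddf_sum; apply: eq_bigr => i _; rewrite !mxE.
    by case: (v 0 i) => p q /=; rewrite mulr0 subr0.
  by rewrite e /a /b; move: (c) (v 0 j) => [p q] [u w]; rewrite /=.
have yA : y *m A = b *: x + a *: y.
  apply/rowP => j; have /rowP/(_ j) := vA; rewrite !mxE => e.
  have -> : \sum_i y 0 i * A i j = complex.Im (\sum_i v 0 i * map_mx f A i j).
    rewrite raddf_sum; apply: eq_bigr => i _; rewrite !mxE.
    by case: (v 0 i) => p q /=; rewrite mulr0 add0r.
  by rewrite e /a /b; move: (c) (v 0 j) => [p q] [u w]; rewrite /=; rewrite addrC.
have vxy : (x != 0) || (y != 0).
  rewrite -negb_and; apply: contra v0 => /andP [/eqP x0 /eqP y0].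
  apply/eqP/rowP => j; rewrite mxE.
  have /rowP/(_ j) := x0; have /rowP/(_ j) := y0; rewrite !mxE.
  by case: (v 0 j) => p q /= -> ->.
have b0 : b = 0.
  have e : x *m A *m y^T = x *m (y *m A)^T by rewrite trmx_mul As mulmxA.
  move: e; rewrite xA yA => /(congr1 mxtrace).
  rewrite mulmxBl [(_ + _)^T]linearD /= mulmxDr [(b *: x)^T]linearZ [(a *: y)^T]linearZ /=.
  rewrite -!scalemxAl -!scalemxAr linearB linearD /= !linearZ /=.
  move=> e.
  have : b * (normsq x^T + normsq y^T) = 0.
    by rewrite /normsq !trmxK; move: e; rewrite [b *: _]mulrN; lra.
  rewrite !normsq_tr => /eqP; rewrite mulf_eq0 => /orP [/eqP //|].
  rewrite paddr_eq0 ?normsq_ge0 // => /andP [/eqP/normsq_eq0 x0 /eqP/normsq_eq0 y0].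
  by move: vxy; rewrite x0 y0 eqxx.
move: xA yA; rewrite b0 !scale0r subr0 add0r => xA yA.
by case/orP: vxy => ?; exists a; [exists x | exists y].
Qed.

(* The reflection in the hyperplane orthogonal to a - b swaps the unit vectors a and b. *)
Lemma swap_reflection n (a b : 'cV[R]_n) : normsq a = 1 -> normsq b = 1 ->
  exists Q : 'M[R]_n, [/\ Q^T = Q, Q^T *m Q = 1%:M, Q *m a = b &
    forall p (x : 'M[R]_(n, p)), a^T *m x = 0 -> b^T *m x = 0 -> Q *m x = x].
Proof.
move=> na nb; pose v := a - b; pose q := normsq v.
have aa : a^T *m a = 1%:M by rewrite [LHS]mx11_trace -/(normsq a) na.
have bb : b^T *m b = 1%:M by rewrite [LHS]mx11_trace -/(normsq b) nb.
have [v0|v0] := eqVneq v 0.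
  exists 1%:M; rewrite trmx1 mulmx1 mul1mx; split => //.
    by apply/eqP; rewrite -subr_eq0 -/v v0.
  by move=> p x _ _; rewrite mul1mx.
have q0 : q != 0 by apply: contra v0 => /eqP/normsq_eq0 ->.
have vv : v^T *m v = q%:M by rewrite [LHS]mx11_trace.
have ab : b^T *m a = a^T *m b.
  by rewrite [LHS]mx11_trace -mxtrace_tr trmx_mul trmxK -mx11_trace.
have va : v^T *m a = (q / 2)%:M.
  have e : q%:M = 2 *: (v^T *m a) :> 'M[R]_1.
    rewrite -vv /v [(a - b)^T]linearB /= !mulmxBl !mulmxBr aa bb ab.
    by apply/matrixP => i j; rewrite !mxE; lra.
  by rewrite mulrC -scale_scalar_mx e scalerA mulVf ?scale1r // pnatr_eq0.
pose Q := 1%:M - (2 / q) *: (v *m v^T).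
have Qs : Q^T = Q.
  by rewrite /Q linearB /= trmx1 linearZ /= trmx_mul trmxK.
exists Q; split=> //.
- have WW : v *m v^T *m (v *m v^T) = q *: (v *m v^T).
    by rewrite mulmxA -(mulmxA v) vv mul_mx_scalar -scalemxAl.
  rewrite Qs /Q mulmxBl mul1mx mulmxBr mulmx1 -scalemxAl -scalemxAr WW.
  apply/matrixP => i j; move: (v *m v^T) => W; rewrite !mxE; field.
  exact: q0.
- rewrite /Q mulmxBl mul1mx -scalemxAl -mulmxA va mul_mx_scalar scalerA.
  rewrite (_ : _ * _ = 1) ?scale1r ?subKr //; by field.
- move=> p x ax bx.
  have vx : v^T *m x = 0 by rewrite /v [(a - b)^T]linearB /= mulmxBl ax bx subr0.
  by rewrite /Q mulmxBl mul1mx -scalemxAl -mulmxA vx mulmx0 scaler0 subr0.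
Qed.

(** Deflation: the reflection that moves a unit eigenvector to the first basis vector makes A block
    diagonal, and the induction hypothesis applies to the lower block. *)
Lemma symmetric_diagonalization n (A : 'M[R]_n) : A^T = A ->
  exists (Q : 'M[R]_n) (d : 'rV[R]_n),
    Q^T *m Q = 1%:M /\ A = Q^T *m diag_mx d *m Q.
Proof.
elim: n => [|n IH] in A *.
  by exists 1%:M, 0; split; apply/matrixP => -[].
move=> As; have [a [v [Av nv]]] := symmetric_eigen As.
pose e : 'cV[R]_(1 + n) := col_mx 1%:M 0.
have ne : normsq e = 1 by rewrite /normsq tr_col_mx mul_row_col trmx1 mulmx1 mulmx0 addr0 mxtrace1.
have [H [Hs HH Hv _]] := swap_reflection nv ne.
have He : H *m e = v by rewrite -Hv mulmxA -{1}Hs HH mul1mx.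
pose B : 'M[R]_(1 + n) := H *m A *m H.
have Bs : B^T = B by rewrite /B !trmx_mul Hs As mulmxA.
have Be : B *m e = a *: e by rewrite /B -!mulmxA He Av -scalemxAr Hv.
have [Bul Bdl] : ulsubmx B = a%:M /\ dlsubmx B = 0.
  move: Be; rewrite -{1}[B]submxK /e mul_block_col !mulmx0 !addr0 !mulmx1.
  rewrite scale_col_mx scaler0 => /eq_col_mx [-> ->]; split=> //.
  by rewrite scale_scalar_mx mulr1.
have Bur : ursubmx B = 0 by rewrite -[ursubmx B]trmxK trmx_ursub Bs Bdl trmx0.
have BE : B = block_mx a%:M 0 0 (drsubmx B) by rewrite -{1}[B]submxK Bul Bdl Bur.
have [] := IH (drsubmx B); first by rewrite trmx_drsub Bs.
move=> Q [d [QQ Bd]].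
pose K : 'M[R]_(1 + n) := block_mx 1%:M 0 0 Q.
have KK : K^T *m K = 1%:M.
  rewrite /K tr_block_mx mulmx_block !trmx0 trmx1.
  by rewrite !(mulmx0, mul0mx, mul1mx, addr0, add0r) QQ -scalar_mx_block.
have KBK : B = K^T *m diag_mx (row_mx a%:M d) *m K.
  rewrite BE /K tr_block_mx diag_mx_row !mulmx_block !trmx0 trmx1.
  rewrite !(mulmx0, mul0mx, mul1mx, mulmx1, addr0, add0r) {1}Bd.
  by congr block_mx; apply/matrixP => i j; rewrite !ord1 !mxE.
exists (K *m H), (row_mx a%:M d); split.
  by rewrite [(K *m H)^T]trmx_mul -mulmxA (mulmxA K^T) KK mul1mx HH.
have -> : A = H *m B *m H.
  by rewrite /B !mulmxA -{1}Hs HH mul1mx -mulmxA -{1}Hs HH mulmx1.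
by rewrite KBK [(K *m H)^T]trmx_mul Hs !mulmxA.
Qed.
End RealSpectral.

(** * Quadratic forms *)

Section QuadraticForms.
Context {R : realFieldType}.

Definition quad n p (H : 'M[R]_n) (X : 'M[R]_(n, p)) : R := \tr (X^T *m H *m X).

Lemma quad1 n p (X : 'M[R]_(n, p)) : quad 1%:M X = normsq X.
Proof. by rewrite /quad mulmx1. Qed.

Lemma quadD n p (H K : 'M[R]_n) (X : 'M[R]_(n, p)) :
  quad (H + K) X = quad H X + quad K X.
Proof. by rewrite /quad mulmxDr mulmxDl linearD. Qed.

Lemma quadB n p (H K : 'M[R]_n) (X : 'M[R]_(n, p)) :
  quad (H - K) X = quad H X - quad K X.
Proof. by rewrite /quad mulmxBr mulmxBl linearB. Qed.

Lemma quadZ n p a (H : 'M[R]_n) (X : 'M[R]_(n, p)) : quad (a *: H) X = a * quad H X.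
Proof. by rewrite /quad -scalemxAr -scalemxAl linearZ. Qed.

Lemma quad_gram n p q (Y : 'M[R]_(q, n)) (X : 'M[R]_(n, p)) :
  quad (Y^T *m Y) X = normsq (Y *m X).
Proof. by rewrite /quad /normsq trmx_mul !mulmxA. Qed.

Lemma quad_diag n p (d : 'rV[R]_n) (X : 'M[R]_(n, p)) :
  quad (diag_mx d) X = \sum_i d 0 i * normsq (row i X).
Proof.
rewrite /quad -mulmxA mxtrace_mulC /mxtrace; apply: eq_bigr => i _.
rewrite mul_diag_mx !mxE normsqE big_ord_recl big_ord0 addr0 mulr_sumr.
by apply: eq_bigr => j _; rewrite !mxE mulrA.
Qed.

Lemma quad_conj n l p (Q : 'M[R]_(l, n)) (H : 'M[R]_l) (X : 'M[R]_(n, p)) :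
  quad (Q^T *m H *m Q) X = quad H (Q *m X).
Proof. by rewrite /quad trmx_mul !mulmxA. Qed.

Lemma normsq_delta n (i : 'I_n) : normsq (delta_mx i 0 : 'cV[R]_n) = 1.
Proof. by rewrite /normsq trmx_delta mul_delta_mx /mxtrace big_ord_recl big_ord0 addr0 mxE eqxx. Qed.

Lemma quad_diag_delta n (d : 'rV[R]_n) (i : 'I_n) :
  quad (diag_mx d) (delta_mx i 0 : 'cV[R]_n) = d 0 i.
Proof.
rewrite quad_diag (bigD1 i) //= rowE mul_delta_mx normsq_delta mulr1 big1 ?addr0 //.
move=> j ji; rewrite rowE mul_delta_mx_0 // [normsq _](_ : _ = 0) ?mulr0 //.
by rewrite /normsq mulmx0 mxtrace0.
Qed.

(** Each eigenvalue is a value of the form at a unit vector, so that bounds on the form pass to the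
    spectrum. *)
Lemma quad_diagonalized n (Q : 'M[R]_n) (d : 'rV[R]_n) i : Q^T *m Q = 1%:M ->
  exists x : 'cV[R]_n, normsq x = 1 /\ quad (Q^T *m diag_mx d *m Q) x = d 0 i.
Proof.
move=> QQ; exists (Q^T *m delta_mx i 0); split.
  by rewrite isometry_normsq ?normsq_delta // trmxK; exact: mulmx1C.
by rewrite quad_conj mulmxA (mulmx1C QQ) mul1mx quad_diag_delta.
Qed.

Lemma quad_diag_ge n p (d : 'rV[R]_n) c (X : 'M[R]_(n, p)) :
  (forall i, c <= d 0 i) -> c * normsq X <= quad (diag_mx d) X.
Proof.
move=> cd; rewrite quad_diag normsq_rows mulr_sumr; apply: ler_sum => i _.
by rewrite ler_wpM2r ?normsq_ge0.
Qed.

Lemma quad_diag_le n p (d : 'rV[R]_n) c (X : 'M[R]_(n, p)) :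
  (forall i, d 0 i <= c) -> quad (diag_mx d) X <= c * normsq X.
Proof.
move=> cd; rewrite quad_diag normsq_rows mulr_sumr; apply: ler_sum => i _.
by rewrite ler_wpM2r ?normsq_ge0.
Qed.

Lemma coercive_unitmx n (H : 'M[R]_n) c : 0 < c ->
  (forall x : 'cV[R]_n, c * normsq x <= quad H x) -> H \in unitmx.
Proof.
move=> c0 Hc; rewrite -row_free_unit -kermx_eq0.
apply/eqP/row_matrixP => i; rewrite row0; set x := row i _.
have xH : x *m H = 0 by apply/sub_kermxP; exact: row_sub.
have := Hc x^T; rewrite /quad trmxK xH mul0mx mxtrace0 normsq_tr => le0.
apply: normsq_eq0; apply/eqP; rewrite eq_le normsq_ge0 andbT.
by rewrite -(pmulr_rle0 _ c0).
Qed.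

(** Pythagoras for the orthogonal projection X X^T, whose image of Y has the norm of X^T Y. *)
Lemma stiefel_contract m r p (X : 'M[R]_(m, r)) (Y : 'M[R]_(m, p)) :
  X^T *m X = 1%:M -> normsq Y = normsq (X^T *m Y) + normsq (Y - X *m (X^T *m Y)).
Proof.
move=> XX.
have -> : normsq (X^T *m Y) = normsq (X *m (X^T *m Y)).
  by rewrite /normsq [(X *m _)^T]trmx_mul -mulmxA (mulmxA X^T) XX mul1mx.
rewrite -normsqD_orth; first by rewrite addrC subrK.
by rewrite mulmxBr !trmx_mul trmxK -!mulmxA (mulmxA X^T X) XX mul1mx subrr.
Qed.

Lemma stiefel_contract_le m r p (X : 'M[R]_(m, r)) (Y : 'M[R]_(m, p)) :
  X^T *m X = 1%:M -> normsq (X^T *m Y) <= normsq Y.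
Proof.
by move=> XX; rewrite (stiefel_contract Y XX) lerDl normsq_ge0.
Qed.

(* For 0 <= H <= kappa, the form 0 <= H evaluated at X - H X / kappa gives
   |H X|^2 <= kappa <X, H X>. *)
Lemma quad_smooth n p (H : 'M[R]_n) kappa (X : 'M[R]_(n, p)) :
  H^T = H -> 0 < kappa ->
  (forall Y : 'M[R]_(n, p), 0 <= quad H Y <= kappa * normsq Y) ->
  normsq (H *m X) <= kappa * quad H X.
Proof.
move=> Hs k0 HH; set Y := H *m X.
have /andP[+ _] := HH (X - kappa^-1 *: Y).
have /andP[_] := HH Y.
have -> : quad H (X - kappa^-1 *: Y) =
    quad H X - 2 / kappa * normsq Y + kappa ^- 2 * quad H Y.
  have YX : \tr (Y^T *m H *m X) = normsq Y by rewrite -mulmxA.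
  have XY : \tr (X^T *m H *m Y) = normsq Y.
    by rewrite /normsq {3}/Y trmx_mul Hs.
  rewrite /quad [(X - _)^T]linearB /= [(_ *: Y)^T]linearZ /= !mulmxBl !mulmxBr.
  rewrite -!scalemxAl -!scalemxAr !linearB /= !mxtraceZ XY YX.
  have k0' : kappa != 0 by rewrite gt_eqF.
  by move: (\tr _) (normsq _) (\tr _) => a b c; field.
move=> hY h0; rewrite -(ler_pM2l (k0 : 0 < kappa)) -subr_ge0.
have -> : kappa * (kappa * quad H X) - kappa * normsq Y =
    kappa ^+ 2 * (quad H X - 2 / kappa * normsq Y + kappa ^- 2 * quad H Y)
    + (kappa * normsq Y - quad H Y).
  by field; rewrite gt_eqF.
by rewrite addr_ge0 ?subr_ge0 // mulr_ge0 // sqr_ge0.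
Qed.

End QuadraticForms.

(** * Contraction of the tangent of the angle *)

Section Alignment.
Context {R : realFieldType}.
Variables (m r k : nat) (U : 'M[R]_(m, k)) (d : 'rV[R]_k) (kappa eta : R).
Hypothesis UU : U^T *m U = 1%:M.
Hypothesis kappa1 : 1 < kappa.
Hypothesis d_bounds : forall i, kappa^-1 <= d 0 i <= 1.
Hypothesis eta01 : 0 < eta < 1.

Let A := U *m diag_mx d *m U^T.

(* X *m N is the graph of a linear map from the range of A, so that perp_part X N
   is the tangent of the angle between the range of A and a subspace of the
   range of X. *)
Definition perp_part (X : 'M[R]_(m, r)) (N : 'M[R]_(r, k)) : 'M[R]_(m, k) :=
  (1%:M - U *m U^T) *m (X *m N).

(** The right inverse is existential, so that after each step one can be picked for which the new
    tangent is the old one times an explicit matrix. *)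
Definition aligned (X : 'M[R]_(m, r)) (b : R) :=
  X^T *m X = 1%:M /\
  exists N : 'M[R]_(r, k), U^T *m X *m N = 1%:M /\ normsq (perp_part X N) <= b.

(** [Rt] stands for the inverse square root. For a suitable right inverse the new tangent is T K
    with K = H (H + eta)^-1, and 0 <= H <= kappa bounds K by (1 + eta / kappa)^-1. *)
Lemma aligned_step (X : 'M[R]_(m, r)) b G Rt :
  G = - ((1%:M - X *m X^T) *m (A *m X)) -> Rt^T = Rt ->
  Rt *m Rt *m (1%:M + eta ^+ 2 *: (G^T *m G)) = 1%:M ->
  aligned X b -> aligned ((X - eta *: G) *m Rt) ((1 + eta / kappa) ^- 2 * b).
Proof.
move=> GE Rs RRZ [XX [N [PhiN Nb]]].
have [eta0 eta1] := andP eta01.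
have kappa0 : 0 < kappa by exact: lt_trans kappa1.
have d0 i : 0 < d 0 i.
  by have /andP[+ _] := d_bounds i; apply: lt_le_trans; rewrite invr_gt0.
have XG : X^T *m G = 0.
  by rewrite GE mulmxN mulmxA mulmxBr mulmx1 (mulmxA X^T X) XX mul1mx subrr mul0mx oppr0.
pose Z := 1%:M + eta ^+ 2 *: (G^T *m G).
rewrite -/Z in RRZ.
have RZR : Rt *m (Z *m Rt) = 1%:M by apply: mulmx1C; rewrite -mulmxA; exact: mulmx1C.
have YY : (X - eta *: G)^T *m (X - eta *: G) = Z.
  rewrite [(X - _)^T]linearB /= [(_ *: G)^T]linearZ /= mulmxBl !mulmxBr. rewrite XX.
  rewrite -!scalemxAr -!scalemxAl XG -[G^T *m X]trmxK trmx_mul trmxK XG trmx0.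
  by rewrite !scaler0 subr0 sub0r opprK scalerA -expr2.
have XX' : ((X - eta *: G) *m Rt)^T *m ((X - eta *: G) *m Rt) = 1%:M.
  by rewrite trmx_mul Rs -mulmxA (mulmxA _ _ Rt) YY.
split=> //.
pose Phi := U^T *m X; pose L := diag_mx d; pose M := Phi *m Phi^T.
pose Linv : 'M[R]_k := diag_mx (\row_i (d 0 i)^-1).
have LLinv : L *m Linv = 1%:M.
  rewrite mulmx_diag; apply/matrixP => i j; rewrite !mxE.
  by rewrite mulfV // gt_eqF.
have LinvL : Linv *m L = 1%:M by exact: mulmx1C.
(* This [H] relates both parts of the step to [L *m Phi]: with S = Phi^T L Phi, Phi (1 - eta S) = H
   L Phi and U^T (X - eta G) = (H + eta) L Phi. *)
pose H := Linv - eta *: M.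
have Ms : M^T = M by rewrite /M trmx_mul trmxK.
have Hs : H^T = H by rewrite /H linearB /= tr_diag_mx linearZ /= Ms.
have M1 p (Y : 'M[R]_(k, p)) : 0 <= quad M Y <= normsq Y.
  rewrite (_ : quad M Y = normsq (Phi^T *m Y)) ?normsq_ge0 /=; last first.
    by rewrite -quad_gram trmxK.
  rewrite /Phi trmx_mul trmxK -mulmxA.
  by rewrite (le_trans (stiefel_contract_le _ XX)) // isometry_normsq.
(* Here L^-1 >= 1 and M <= 1, so eta < 1 makes [H] coercive, hence invertible. *)
have Hlow p (Y : 'M[R]_(k, p)) : (1 - eta) * normsq Y <= quad H Y.
  have /andP[_ MY] := M1 _ Y.
  rewrite /H quadB quadZ mulrBl; apply: lerB; last by rewrite ler_pM2l.
  apply: quad_diag_ge => i; rewrite mxE invf_ge1 //.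
  by have /andP[] := d_bounds i.
have Hup p (Y : 'M[R]_(k, p)) : quad H Y <= kappa * normsq Y.
  have /andP[MY _] := M1 _ Y.
  rewrite /H quadB quadZ lerBlDr; apply: le_trans (_ : kappa * normsq Y <= _).
    apply: quad_diag_le => i; rewrite mxE -[kappa]invrK lef_pV2 ?posrE ?invr_gt0 //.
    by have /andP[] := d_bounds i.
  by rewrite lerDl mulr_ge0 // ltW.
have eta1' : 0 < 1 - eta by rewrite subr_gt0.
have H0 p (Y : 'M[R]_(k, p)) : 0 <= quad H Y.
  by apply: le_trans (Hlow _ Y); rewrite mulr_ge0 ?normsq_ge0 // ltW.
have Hu : H \in unitmx by exact: coercive_unitmx eta1' (@Hlow _).
have HLPhi : H *m L *m Phi = Phi - eta *: (M *m L *m Phi).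
  by rewrite /H mulmxBl LinvL mulmxBl mul1mx -!scalemxAl.
clearbody H.
pose He := H + eta%:M.
have Heu : He \in unitmx.
  apply: coercive_unitmx eta0 _ => x; rewrite /He quadD -scalemx1 quadZ quad1.
  by rewrite lerDr.
pose S := Phi^T *m L *m Phi.
have Su : 1%:M - eta *: S \in unitmx.
  apply: coercive_unitmx eta1' _ => x; rewrite quadB quad1 quadZ quad_conj.
  rewrite mulrBl mul1r lerD2l lerN2 ler_pM2l //.
  apply: le_trans (quad_diag_le (c := 1) _ _) _.
    by move=> i; have /andP[] := d_bounds i.
  rewrite mul1r /Phi -mulmxA (le_trans (stiefel_contract_le _ UU)) //.
  by rewrite isometry_normsq.
have Ru : Rt \in unitmx by case: (mulmx1_unit RZR).
have AX : A *m X = U *m L *m Phi by rewrite /A -!mulmxA.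
have XAX : X^T *m (A *m X) = S by rewrite AX /S /Phi !trmx_mul trmxK !mulmxA.
have YE : X - eta *: G = X + eta *: (A *m X) - eta *: (X *m S).
  by rewrite GE scalerN opprK mulmxBl mul1mx -(mulmxA X) XAX scalerBr addrA.
have PhiS : Phi *m S = M *m L *m Phi by rewrite /S /M !mulmxA.
have UY : U^T *m (X - eta *: G) = He *m L *m Phi.
  have ULPhi : U^T *m (U *m L *m Phi) = L *m Phi by rewrite -mulmxA mulmxA UU mul1mx.
  rewrite /He !mulmxDl HLPhi mul_scalar_mx -scalemxAl addrAC.
  by rewrite YE mulmxBr mulmxDr -!scalemxAr AX ULPhi (mulmxA U^T X S) -/Phi PhiS.
have PS : Phi *m (1%:M - eta *: S) = H *m L *m Phi.
  by rewrite mulmxBr mulmx1 -scalemxAr HLPhi PhiS.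
pose P := 1%:M - U *m U^T.
have PAX : P *m (A *m X) = 0.
  by rewrite AX /P !mulmxA mulmxBl mul1mx -(mulmxA U) UU mulmx1 subrr !mul0mx.
have VY : P *m (X - eta *: G) = P *m X *m (1%:M - eta *: S).
  rewrite YE (mulmxBr P) (mulmxDr P) -!scalemxAr PAX scaler0 addr0.
  by rewrite mulmxBr mulmx1 -scalemxAr mulmxA.
have {}PhiN : Phi *m N = 1%:M by [].
clear AX XAX.
clearbody S M L Phi.
pose K := H *m invmx He.
(* The first two factors undo [Rt] and 1 - eta S. The last one, [K], cancels the factor (H + eta)
   H^-1 that U^T X N has acquired. *)
exists (invmx Rt *m invmx (1%:M - eta *: S) *m N *m K); split.
  rewrite !mulmxA UY -(mulmxA _ Rt) mulmxV // mulmx1.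
  have -> : He *m L *m Phi = He *m invmx H *m (Phi *m (1%:M - eta *: S)).
    by rewrite PS !mulmxA -(mulmxA He _ H) mulVmx // mulmx1.
  rewrite !mulmxA -(mulmxA _ (1%:M - _)) mulmxV // mulmx1.
  rewrite -(mulmxA _ Phi N) PhiN mulmx1 -(mulmxA He _ H) mulVmx //.
  by rewrite mulmx1 mulmxV.
set T := perp_part X N in Nb.
have -> : perp_part ((X - eta *: G) *m Rt)
    (invmx Rt *m invmx (1%:M - eta *: S) *m N *m K) = T *m K.
  rewrite /perp_part !mulmxA -(mulmxA _ Rt) mulmxV // mulmx1.
  rewrite VY -(mulmxA _ (1%:M - _)) mulmxV // mulmx1.
  by rewrite /T /perp_part !mulmxA.
clearbody T.
rewrite -(ler_pM2l (_ : 0 < (1 + eta / kappa) ^+ 2)); last first.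
  by rewrite exprn_gt0 // addr_gt0 // divr_gt0.
rewrite mulVKf; last by rewrite expf_neq0 // gt_eqF // addr_gt0 // divr_gt0.
apply: le_trans Nb.
(* With V := T (H + eta)^-1, this compares V H with V (H + eta). *)
pose V := (T *m invmx He)^T.
have Hes : He^T = He by rewrite /He linearD /= Hs tr_scalar_mx.
have HHe : invmx He *m H = H *m invmx He.
  have : He *m H = H *m He.
    by rewrite /He mulmxDl mulmxDr mul_scalar_mx mul_mx_scalar.
  move=> /(congr1 (fun B => invmx He *m B *m invmx He)).
  by rewrite !mulmxA mulVmx // mul1mx -!mulmxA mulmxV // mulmx1.
have TK : normsq (T *m K) = normsq (H *m V).
  rewrite -normsq_tr; congr normsq; rewrite /V /K !trmx_mul trmx_inv Hes Hs.
  by rewrite HHe mulmxA.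
have TE : normsq T = normsq (H *m V + eta *: V).
  rewrite -mul_scalar_mx -mulmxDl -/He -[RHS]normsq_tr trmx_mul trmxK Hes.
  by rewrite -mulmxA mulVmx // mulmx1.
rewrite TK TE.
(* The comparison is termwise: the terms |H V|^2 agree, the cross terms compare by |H V|^2 <= kappa
   <V, H V>, and the last ones by |H V|^2 <= kappa^2 |V|^2. *)
have -> : normsq (H *m V + eta *: V) = normsq (H *m V) + 2 * eta * quad H V + eta ^+ 2 * normsq V.
  have VHV : \tr (V^T *m (H *m V)) = quad H V by rewrite /quad mulmxA.
  have HVV : \tr ((H *m V)^T *m V) = quad H V by rewrite trmx_mul Hs.
  rewrite /normsq [(_ + _)^T]linearD /= [(_ *: V)^T]linearZ /= !mulmxDl !mulmxDr.
  rewrite -!scalemxAl -!scalemxAr !mxtraceD !mxtraceZ VHV HVV; ring.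
have sm : normsq (H *m V) <= kappa * quad H V.
  by apply: quad_smooth => // Y; rewrite H0 Hup.
have sm2 : quad H V <= kappa * normsq V by exact: Hup.
have kk : kappa * kappa^-1 = 1 by rewrite mulfV // gt_eqF.
have -> : (1 + eta / kappa) ^+ 2 * normsq (H *m V) = normsq (H *m V) +
  2 * eta * (kappa^-1 * normsq (H *m V)) + eta ^+ 2 * (kappa ^- 2 * normsq (H *m V)).
  by field; rewrite gt_eqF.
have eta0' := ltW eta0.
rewrite -!addrA lerD2l; apply: lerD; apply: ler_wpM2l; rewrite ?mulr_ge0 ?sqr_ge0 //.
  by rewrite ler_pdivrMl.
rewrite -exprVn expr2 -mulrA !ler_pdivrMl //.
by apply: le_trans sm _; rewrite ler_pM2l.
Qed.
End Alignment.

(** * From the tangent of the angle to the objective *)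

(** With S = X X^T and D = (1 - S) A, the error is -(D + S D^T), a sum of two orthogonal matrices of
    norm at most |D|. As U + T = X N lies in the range of X, (1 - S) U = - (1 - S) T, whence |D| <=
    |T|. *)
Lemma projection_error (R : realFieldType) m r k (X : 'M[R]_(m, r)) (U : 'M[R]_(m, k))
    (L : 'M[R]_k) (N : 'M[R]_(r, k)) :
  X^T *m X = 1%:M -> U^T *m U = 1%:M -> L^T = L ->
  (forall Y : 'M[R]_(k, m), normsq (L *m Y) <= normsq Y) ->
  U^T *m X *m N = 1%:M ->
  normsq (X *m (X^T *m (U *m L *m U^T) *m X) *m X^T - U *m L *m U^T)
    <= 2 * normsq (perp_part U X N).
Proof.
move=> XX UU Ls L1 UXN; set T := perp_part U X N.
pose S := X *m X^T; pose A := U *m L *m U^T.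
have Ss : S^T = S by rewrite /S trmx_mul trmxK.
have SS : S *m S = S by rewrite /S mulmxA -(mulmxA X) XX mulmx1.
pose D := A - S *m A.
have DE : X *m (X^T *m A *m X) *m X^T - A = - (D + S *m (A - A *m S)).
  have -> : X *m (X^T *m A *m X) *m X^T = S *m A *m S by rewrite /S !mulmxA.
  by rewrite (mulmxBr S) (mulmxA S A S) /D addrA subrK opprB.
have As : A^T = A by rewrite /A !trmx_mul trmxK Ls mulmxA.
have DT : A - A *m S = D^T by rewrite /D [(_ - _)^T]linearB /= (trmx_mul S A) As Ss.
rewrite {}DT in DE.
have SD : S *m D = 0 by rewrite /D (mulmxBr S) (mulmxA S S) SS subrr.
have DSD : D^T *m (S *m D^T) = 0.
  by rewrite mulmxA -{1}Ss -(trmx_mul S D) SD trmx0 mul0mx.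
rewrite DE normsqN normsqD_orth //.
have ST : normsq (S *m D^T) <= normsq D.
  rewrite /S -mulmxA isometry_normsq // -(normsq_tr D).
  exact: stiefel_contract_le.
suff DT' : normsq D <= normsq T by rewrite mulr2n mulrDl !mul1r; apply: lerD => //; apply: le_trans DT'.
have XN : X *m N = U + T.
  by rewrite /T /perp_part mulmxBl mul1mx -mulmxA (mulmxA U^T) UXN mulmx1 addrC subrK.
have UE : U - S *m U = - (T - S *m T).
  have -> : U = X *m N - T by rewrite XN addrK.
  have SXN : S *m (X *m N) = X *m N by rewrite /S -mulmxA (mulmxA X^T) XX mul1mx.
  rewrite (mulmxBr S) SXN.
  by rewrite [RHS]opprB opprB addrC addrA subrK.
have -> : D = - (T - S *m T) *m (L *m U^T) by rewrite -UE /D /A mulmxBl !mulmxA.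
clearbody T.
rewrite mulNmx normsqN -normsq_tr trmx_mul trmx_mul trmxK Ls -mulmxA.
rewrite isometry_normsq //; apply: le_trans (L1 _) _.
rewrite normsq_tr [leRHS](stiefel_contract _ XX) /S -mulmxA.
by rewrite lerDr normsq_ge0.
Qed.

Lemma diag_contract (R : realFieldType) n p (d : 'rV[R]_n) (Y : 'M[R]_(n, p)) :
  (forall i, 0 <= d 0 i <= 1) -> normsq (diag_mx d *m Y) <= normsq Y.
Proof.
move=> d01; rewrite (normsq_rows Y) (normsq_rows (diag_mx d *m Y)); apply: ler_sum => i _.
have -> : row i (diag_mx d *m Y) = d 0 i *: row i Y.
  by apply/rowP => j; rewrite mul_diag_mx !mxE.
have /andP[d0 d1] := d01 i.
by rewrite normsqZ ler_piMl ?normsq_ge0 // expr_le1.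
Qed.

(** * Initial tangent from a Gram determinant *)

Section InitialAlignment.
Context {R : rcfType}.

(** For M = Phi Phi^T the pseudo-inverse N = Phi^T M^-1 has |N|^2 = tr M^-1. The eigenvalues of M
    are at most 1, so each of them is at least their product det M. *)
Lemma gram_inverse_normsq k r (Phi : 'M[R]_(k, r)) theta :
  0 < theta -> theta <= \det (Phi *m Phi^T) ->
  (forall y : 'cV[R]_k, normsq (Phi^T *m y) <= normsq y) ->
  exists N : 'M[R]_(r, k), Phi *m N = 1%:M /\ normsq N <= k%:R / theta.
Proof.
move=> th0; set M := Phi *m Phi^T => thM PhiC.
have Ms : M^T = M by rewrite /M trmx_mul trmxK.
have Mu : M \in unitmx by rewrite unitmxE unitfE gt_eqF // (lt_le_trans th0).
have quadM (y : 'cV_k) : quad M y = normsq (Phi^T *m y) by rewrite -quad_gram trmxK.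
have [Q [e [QQ ME]]] := symmetric_diagonalization Ms.
have QQ' : Q *m Q^T = 1%:M by exact: mulmx1C.
have e01 i : 0 <= e 0 i <= 1.
  have [y [y1 <-]] := quad_diagonalized e i QQ; rewrite -ME quadM normsq_ge0 /=.
  by rewrite -y1.
have detM : \det M = \prod_i e 0 i.
  rewrite ME !det_mulmx det_diag mulrAC -det_mulmx QQ det1 mul1r //.
have eth i : theta <= e 0 i.
  apply: le_trans thM _; rewrite detM (bigD1 i) //= ler_piMr //.
    by have /andP[] := e01 i.
  by apply: prodr_ile1 => j _; exact: e01.
have e0 i : 0 < e 0 i by exact: lt_le_trans (eth i).
pose f : 'rV[R]_k := \row_i (e 0 i)^-1.
have MF : M *m (Q^T *m diag_mx f *m Q) = 1%:M.
  rewrite ME !mulmxA -(mulmxA _ Q Q^T) QQ' mulmx1 -(mulmxA Q^T) mulmx_diag.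
  rewrite (_ : diag_mx _ = 1%:M) ?mulmx1 //.
  by apply/matrixP => i j; rewrite !mxE mulfV // gt_eqF.
have MV : invmx M = Q^T *m diag_mx f *m Q.
  by rewrite -[LHS]mulmx1 -MF (mulmxA (invmx M) M) mulVmx // mul1mx.
exists (Phi^T *m invmx M); split; first by rewrite mulmxA mulmxV.
rewrite /normsq trmx_mul trmxK trmx_inv Ms mulmxA -(mulmxA _ Phi) -/M mulVmx // mul1mx.
rewrite MV -mulmxA mxtrace_mulC -mulmxA QQ' mulmx1 mxtrace_diag.
rewrite -[k in k%:R]card_ord -sum1_card natr_sum mulr_suml; apply: ler_sum => i _.
by rewrite mxE mul1r lef_pV2 ?posrE.
Qed.

Lemma aligned_init m r k (X : 'M[R]_(m, r)) (U : 'M[R]_(m, k)) theta :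
  X^T *m X = 1%:M -> U^T *m U = 1%:M -> 0 < theta ->
  theta <= \det ((U^T *m X) *m (U^T *m X)^T) -> aligned U X (k%:R / theta).
Proof.
move=> XX UU th0 th; split => //.
have [y|N [PN nN]] := gram_inverse_normsq th0 th.
  rewrite trmx_mul trmxK -mulmxA (le_trans (stiefel_contract_le _ XX)) //.
  by rewrite isometry_normsq.
exists N; split=> //; apply: le_trans nN.
rewrite /perp_part -[leRHS](isometry_normsq N XX) mulmxBl mul1mx -mulmxA.
by rewrite [leRHS](stiefel_contract _ UU) lerDr normsq_ge0.
Qed.

End InitialAlignment.

(** * The iterates of the method *)

(** X^T Gh = 1 - X^T A X is symmetric, so the skew term vanishes, and 1 - X X^T kills the summand X
    of Gh. *)
Lemma tangent_gradient (R : realFieldType) m r (A : 'M[R]_m) (X : 'M[R]_(m, r)) :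
  A^T = A -> X^T *m X = 1%:M ->
  let Gh := (X *m X^T - A) *m X in
  (1%:M - X *m X^T) *m Gh + 2%:R^-1 *: (X *m (X^T *m Gh - Gh^T *m X)) =
  - ((1%:M - X *m X^T) *m (A *m X)).
Proof.
move=> As XX Gh.
have GE : Gh = X - A *m X by rewrite /Gh mulmxBl -mulmxA XX mulmx1.
have XG : X^T *m Gh = 1%:M - X^T *m A *m X by rewrite GE (mulmxBr X^T) XX mulmxA.
have GX : Gh^T *m X = 1%:M - X^T *m A *m X.
  by rewrite GE [(X - _)^T]linearB /= (trmx_mul A) As mulmxBl XX.
rewrite XG GX subrr mulmx0 scaler0 addr0 GE mulmxBr [X in X - _](_ : _ = 0) ?sub0r //.
by rewrite mulmxBl mul1mx -mulmxA XX mulmx1 subrr.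
Qed.

Section Iterates.
Context {R : realType}.

Lemma frobenius_sqr m n (X : 'M[R]_(m, n)) : frobenius X ^+ 2 = normsq X.
Proof. by rewrite /frobenius -normsqE sqr_sqrtr // normsq_ge0. Qed.

Lemma psd_sym_quad n p (H : 'M[R]_n) (X : 'M[R]_(n, p)) : psd_sym H -> 0 <= quad H X.
Proof.
move=> [_ HH]; rewrite /quad /mxtrace; apply: sumr_ge0 => i _.
have := HH (col i X); congr (_ <= _).
rewrite -!mulmxA !mxE; apply: eq_bigr => j _; rewrite !mxE; congr (_ * _).
by apply: eq_bigr => l _; rewrite !mxE.
Qed.

Lemma invsqrtmx_spec n (Z : 'M[R]_n) : Z^T = Z ->
  (forall x : 'cV[R]_n, normsq x <= quad Z x) ->
  (invsqrtmx Z)^T = invsqrtmx Z /\ invsqrtmx Z *m invsqrtmx Z *m Z = 1%:M.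
Proof.
move=> Zs Z1.
(* Once some square root exists, [xget] does not return its default value 0. *)
suff [B HB] : exists B : 'M[R]_n, psd_sym B /\ B *m B *m Z = 1%:M.
  by rewrite /invsqrtmx; case: xgetP => [C _ [[]]|/(_ B)] //; case.
have [Q [d [QQ ZE]]] := symmetric_diagonalization Zs.
have QQ' : Q *m Q^T = 1%:M by exact: mulmx1C.
have d1 i : 1 <= d 0 i.
  by have [x [x1 <-]] := quad_diagonalized d i QQ; rewrite -ZE -x1.
have d0 i : 0 < d 0 i by exact: lt_le_trans (d1 i).
pose s : 'rV[R]_n := \row_i (Num.sqrt (d 0 i))^-1.
exists (Q^T *m diag_mx s *m Q); split.
  split; first by rewrite !trmx_mul trmxK tr_diag_mx mulmxA.
  move=> x; rewrite [_ *m x]mx11_trace mxE eqxx mulr1n -/(quad _ _) quad_conj.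
  apply: le_trans (quad_diag_ge (c := 0) _ _); first by rewrite mul0r.
  by move=> i; rewrite mxE invr_ge0 sqrtr_ge0.
rewrite ZE !mulmxA -(mulmxA _ Q Q^T) QQ' mulmx1 -(mulmxA _ Q Q^T) QQ' mulmx1.
rewrite -(mulmxA Q^T) -(mulmxA Q^T) !mulmx_diag.
rewrite (_ : diag_mx _ = 1%:M) ?mulmx1 //; apply/matrixP => i j; rewrite !mxE.
by rewrite -expr2 exprVn sqr_sqrtr ?ltW // mulVf // gt_eqF.
Qed.

Lemma psd_factorization m (A : 'M[R]_m) kappa : 0 < kappa ->
  psd_sym A -> largest_singular_value A 1 -> smallest_nonzero_singular_value A kappa^-1 ->
  exists k (U : 'M[R]_(m, k)) (d : 'rV[R]_k),
  [/\ \rank A = k, (0 < k)%N, U^T *m U = 1%:M, A = U *m diag_mx d *m U^T &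
      forall i, kappa^-1 <= d 0 i <= 1].
Proof.
move=> kappa0 Apsd [_ large] [[_ kev] kn0 small].
have As : A^T = A by case: Apsd.
have [Q [e [QQ AE]]] := symmetric_diagonalization As.
have QQ' : Q *m Q^T = 1%:M by exact: mulmx1C.
(* A positive semidefinite matrix has its eigenvalues as singular values; the hypotheses on the
   latter then bound the diagonal entries. *)
have sv i : singular_value A (e 0 i).
  split.
    by have [x [_ <-]] := quad_diagonalized e i QQ; rewrite -AE psd_sym_quad.
  pose v : 'rV[R]_m := delta_mx 0 i *m Q.
  have vA : v *m A = e 0 i *: v.
    rewrite AE /v !mulmxA -(mulmxA _ Q) QQ' mulmx1 scalemxAl; congr (_ *m _).
    apply/rowP => j; rewrite mul_mx_diag !mxE.
    by have [->|_] := eqVneq j i; rewrite ?andbT ?andbF /= ?mul0r ?mulr0 // mulrC.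
  apply/eigenvalueP; exists v; first by rewrite As mulmxA vA -scalemxAl vA scalerA expr2.
  apply/eqP => /(congr1 (fun w => (w *m Q^T) 0 i)).
  rewrite /v -mulmxA QQ' mulmx1 mul0mx !mxE !eqxx => /eqP; by rewrite oner_eq0.
pose I := [pred i | e 0 i != 0].
pose f (j : 'I_#|I|) : 'I_m := enum_val j.
(* The rows of [Q] are eigenvectors; those with nonzero eigenvalue become the columns of [U]. *)
pose U : 'M[R]_(m, #|I|) := \matrix_(a, j) Q (f j) a.
pose d : 'rV[R]_#|I| := \row_j e 0 (f j).
have UU : U^T *m U = 1%:M.
  apply/matrixP => a b; have /matrixP/(_ (f a) (f b)) := QQ'; rewrite !mxE.
  rewrite (inj_eq enum_val_inj) => <-; apply: eq_bigr => i _; by rewrite !mxE.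
have AU : A = U *m diag_mx d *m U^T.
  rewrite [LHS]AE; apply/matrixP => a b; rewrite !mxE.
  rewrite (bigID (mem I)) /= [X in _ + X]big1 ?addr0; last first.
    by move=> i; rewrite inE negbK mul_mx_diag !mxE => /eqP ->; rewrite mulr0 mul0r.
  rewrite big_enum_val; apply: eq_bigr => j _.
  by rewrite !mul_mx_diag !mxE.
have db i : kappa^-1 <= d 0 i <= 1.
  rewrite mxE large // small //.
  by have := enum_valP i; rewrite inE.
have rk : \rank A = #|I|.
  apply/eqP; rewrite eqn_leq {1}AU -mulmxA (leq_trans (mxrankM_maxl _ _)) ?rank_leq_col //=.
  have <- : \rank (diag_mx d) = #|I|.
    apply: mxrank_unit; rewrite unitmxE det_diag unitfE; apply/prodf_neq0 => i _.
    by rewrite gt_eqF //; have /andP[+ _] := db i; apply: lt_le_trans; rewrite invr_gt0.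
  have -> : diag_mx d = U^T *m A *m U.
    by rewrite AU !mulmxA UU mul1mx -mulmxA UU mulmx1.
  by rewrite (leq_trans (mxrankM_maxl _ _)) // mxrankM_maxr.
exists #|I|, U, d; split=> //.
(* If A were 0, the nonzero number kappa^-1 could not be a singular value of A. *)
rewrite -rk lt0n mxrank_eq0; apply/eqP => A0.
have /eigenvalueP [v + v0] := kev.
rewrite A0 trmx0 mulmx0 mulmx0 => /esym/eqP; rewrite scaler_eq0 (negPf v0) orbF.
by rewrite expf_eq0 /= (negPf kn0).
Qed.

Section FixedTarget.
Variables (m r k : nat) (U : 'M[R]_(m, k)) (d : 'rV[R]_k) (kappa eta : R).
Hypothesis UU : U^T *m U = 1%:M.
Hypothesis kappa1 : 1 < kappa.
Hypothesis d_bounds : forall i, kappa^-1 <= d 0 i <= 1.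
Hypothesis eta01 : 0 < eta < 1.

Let A := U *m diag_mx d *m U^T.

Lemma aligned_dmd_step (X : 'M[R]_(m, r)) b :
  aligned U X b -> aligned U (dmd_step A eta X) ((1 + eta / kappa) ^- 2 * b).
Proof.
move=> XU; have [XX _] := XU.
pose Z := 1%:M + eta ^+ 2 *: ((dmd_grad A X)^T *m dmd_grad A X).
have [||Rs RR] := @invsqrtmx_spec _ Z.
- by rewrite /Z linearD /= trmx1 linearZ /= trmx_mul trmxK.
- move=> x; rewrite /Z quadD quad1 quadZ quad_gram lerDl.
  by rewrite mulr_ge0 ?sqr_ge0 ?normsq_ge0.
rewrite /dmd_step -/Z; apply: (aligned_step UU kappa1 d_bounds eta01) => //.
apply: tangent_gradient => //.
by rewrite /A !trmx_mul trmxK tr_diag_mx mulmxA.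
Qed.

Lemma aligned_dmd_X (X : 'M[R]_(m, r)) b t :
  aligned U X b -> aligned U (dmd_X A eta X t) ((1 + eta / kappa) ^- (2 * t) * b).
Proof.
move=> XU; elim: t => [|t IH]; first by rewrite muln0 expr0 invr1 mul1r.
by rewrite mulnS exprD invfM -mulrA; exact: aligned_dmd_step.
Qed.

Lemma dmd_Theta2 (X : 'M[R]_(m, r)) Theta t :
  dmd_Theta A eta 2%:R X Theta t = (dmd_X A eta X t)^T *m A *m dmd_X A eta X t.
Proof.
by case: t => [|t] /=; rewrite divff ?pnatr_eq0 // subrr scale0r add0r scale1r.
Qed.

Lemma aligned_objective (X : 'M[R]_(m, r)) b : aligned U X b ->
  objective A X (X^T *m A *m X) <= b / 2.
Proof.
move=> [XX [N [UXN Nb]]]; rewrite /objective frobenius_sqr.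
have dC (Y : 'M[R]_(k, m)) : normsq (diag_mx d *m Y) <= normsq Y.
  apply: diag_contract => i; have /andP[di ->] := d_bounds i.
  by rewrite (le_trans _ di) // invr_ge0 ltW // (lt_trans ltr01).
have := projection_error XX UU (tr_diag_mx d) dC UXN; rewrite -/A.
move: (normsq _) => x xb; lra.
Qed.

Lemma dmd_objective (X : 'M[R]_(m, r)) Theta b t : aligned U X b ->
  objective A (dmd_X A eta X t) (dmd_Theta A eta 2%:R X Theta t) <=
    (1 + eta / kappa) ^- (2 * t) * b / 2.
Proof.
by move=> XU; rewrite dmd_Theta2; apply: aligned_objective; exact: aligned_dmd_X.
Qed.

End FixedTarget.
End Iterates.

(** * Small ball estimate on a grid *)

Section GridSums.
Context {R : realType}.

(* A bounded function whose increments dominate the Gaussian kernel, so that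
   Gaussian sums over an arithmetic progression telescope. *)
Let sat (x : R) := x / (1 + `|x|).

Let sat_bound x : `|sat x| <= 1.
Proof.
rewrite /sat normrM normfV [`|1 + _|]ger0_norm ?addr_ge0 //.
by rewrite ler_pdivrMr ?mul1r ?lerDr // ltr_wpDr.
Qed.

(** Both sides are compared with h / ((1 + |x|) (2 + |x|)), through exp(- x^2) <= 1 / (1 + x^2) on
    the left and h <= 1 on the right. *)
Let gauss_sat (x h : R) : 0 < h <= 1 -> h * expR (- x ^+ 2) <= 7 / 2 * (sat (x + h) - sat x).
Proof.
move=> /andP[h0 h1]; set y := `|x|.
have y0 : 0 <= y by exact: normr_ge0.
have xy : x ^+ 2 = y ^+ 2 by rewrite /y real_normK ?num_real.
have e1 : expR (- x ^+ 2) <= (1 + y ^+ 2)^-1.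
  rewrite expRN lef_pV2 ?posrE ?expR_gt0 ?ltr_wpDr ?sqr_ge0 // xy.
  exact: expR_ge1Dx.
have e2 : (1 + y ^+ 2)^-1 <= 7 / 2 / ((1 + y) * (2 + y)).
  rewrite ler_pdivlMr; last by rewrite mulr_gt0 // ltr_wpDr.
  rewrite mulrC ler_pdivrMr ?ltr_wpDr ?sqr_ge0 //.
  (* The difference of the two sides is 5/2 y^2 - 3 y + 3/2, a positive quadratic with minimum at y
     = 3/5. *)
  by have := sqr_ge0 (y - 3 / 5); nra.
suff e3 : h / ((1 + y) * (2 + y)) <= sat (x + h) - sat x.
  apply: le_trans (_ : h * (7 / 2 / ((1 + y) * (2 + y))) <= _).
    by rewrite ler_pM2l // (le_trans e1).
  by rewrite mulrCA ler_pM2l ?divr_gt0.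
rewrite /sat /y; have [x0|x0] := leP 0 x.
  rewrite !ger0_norm ?addr_ge0 ?(ltW h0) //.
  have -> : (x + h) / (1 + (x + h)) - x / (1 + x) = h / ((1 + x) * (1 + (x + h))).
    by field; rewrite !gt_eqF //; lra.
  by rewrite ler_pM2l // lef_pV2 ?posrE ?mulr_gt0 ?ler_pM2l; lra.
have [xh|xh] := leP (x + h) 0.
  rewrite ler0_norm ?(ltW x0) // ler0_norm //.
  have -> : (x + h) / (1 - (x + h)) - x / (1 - x) = h / ((1 - x) * (1 - (x + h))).
    by field; rewrite !gt_eqF //; lra.
  by rewrite ler_pM2l // lef_pV2 ?posrE ?mulr_gt0 ?ler_pM2l; lra.
(* The interval contains 0. Both endpoints are at most 1 in absolute value, so the increment is at
   least (x + h) / 2 + (- x) / 2 = h / 2. *)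
rewrite ltr0_norm // gtr0_norm //.
have a1 : (x + h) / 2 <= (x + h) / (1 + (x + h)).
  by rewrite ler_pM2l // lef_pV2 ?posrE; lra.
have a2 : - x / 2 <= - x / (1 - x).
  by rewrite ler_pM2l ?oppr_gt0 // lef_pV2 ?posrE; lra.
have a3 : h / ((1 - x) * (2 - x)) <= h / 2.
  have p : 2 <= (1 - x) * (2 - x) by nra.
  by rewrite ler_pM2l // lef_pV2 ?posrE ?(lt_le_trans _ p).
by move: a1 a2 a3; rewrite mulNr; lra.
Qed.

(** The telescoped sum is 7/2 times a difference of two values of [sat], which is at most 2. The
    bound is uniform in the length [L] and the offset [b]. *)
Lemma gauss_sum_le L (h b : R) : 0 < h <= 1 ->
  \sum_(l < L) expR (- (h * l%:R + b) ^+ 2) <= 7 / h.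
Proof.
move=> h01; have [h0 h1] := andP h01.
rewrite ler_pdivlMr // mulrC mulr_sumr.
apply: (@le_trans _ _ (\sum_(l < L) 7 / 2 * (sat (h * l.+1%:R + b) - sat (h * l%:R + b)))).
  apply: ler_sum => l _; rewrite (_ : h * l.+1%:R + b = h * l%:R + b + h).
    exact: gauss_sat.
  by rewrite -natr1; ring.
rewrite -mulr_sumr -(big_mkord xpredT (fun l => sat (h * l.+1%:R + b) - sat (h * l%:R + b))).
rewrite telescope_sumr //.
have := sat_bound (h * L%:R + b); have := sat_bound (h * 0%:R + b).
by rewrite !ler_norml; lra.
Qed.

Definition upd (I : finType) (T : finType) (g : {ffun I -> T}) j l : {ffun I -> T} :=
  [ffun i => if i == j then l else g i].

(** Resampling one coordinate: exchanging [g j] and [l] is an involution on the pairs (g, l). *)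
Lemma sum_upd (I T : finType) (H : {ffun I -> T} -> R) j :
  \sum_g \sum_l H (upd g j l) = #|T|%:R * \sum_g H g.
Proof.
pose phi (p : {ffun I -> T} * T) := (upd p.1 j p.2, p.1 j).
have phiK : involutive phi.
  move=> [g l]; rewrite /phi /=; congr (_, _); last by rewrite ffunE eqxx.
  by apply/ffunP => i; rewrite !ffunE; case: eqP => // ->.
rewrite pair_bigA /= -(reindex_inj (inv_inj phiK) (P := xpredT) (F := fun p => H p.1)).
rewrite -(pair_bigA _ (fun g _ => H g)) mulr_sumr; apply: eq_bigr => g _.
by rewrite sumr_const mulr_natl.
Qed.

Variables (m L : nat).
Hypothesis m0 : (0 < m)%N.
Hypothesis L0 : (0 < L)%N.

(** A uniform grid in the cube [0, 1)^m serves as a finite substitute for a random direction. *)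
Definition grid_vec (g : {ffun 'I_m -> 'I_L}) : 'cV[R]_m :=
  \col_i ((g i)%:R / L%:R).

Lemma normsq_grid_vec g : normsq (grid_vec g) <= m%:R.
Proof.
rewrite normsqE -[m in m%:R]card_ord -sum1_card natr_sum; apply: ler_sum => i _.
rewrite big_ord_recl big_ord0 addr0 mxE expr_le1 ?divr_ge0 //.
by rewrite ler_pdivrMr ?ltr0n // mul1r ler_nat ltnW.
Qed.

(** Induction on the number [s] of pivots. Each one lowers the trace of the projection S by 1 and
    gains a factor 7 / theta from a one-dimensional Gaussian sum. The reserve [tau] in the trace
    keeps every pivot at least tau / m. *)
Lemma sum_gauss_grid s (S : 'M[R]_m) (lambda theta tau : R) :
  0 < theta -> 0 <= tau -> 0 < lambda <= L%:R ^+ 2 ->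
  theta ^+ 2 * m%:R <= lambda * tau ->
  S^T = S -> S *m S = S -> tau + s%:R <= \tr S ->
  \sum_g expR (- (lambda * quad S (grid_vec g))) <= (7 / theta) ^+ s * (L ^ m)%:R.
Proof.
move=> th0 tau0 /andP[la0 laL] thla; elim: s S => [|s IH] S Ss SS trS.
  rewrite expr0 mul1r -[in (L ^ m)%:R](card_ord L) -[in (_ ^ m)%:R](card_ord m) -card_ffun.
  rewrite -sum1_card natr_sum; apply: ler_sum => g _.
  rewrite -expR0 ler_expR oppr_le0 mulr_ge0 ?(ltW la0) //.
  by rewrite -SS -{1}Ss quad_gram normsq_ge0.
have m0' : 0 < m%:R :> R by rewrite ltr0n.
(* The pivot is a diagonal entry that is at least the average of the lower bound on the trace. *)
have [j Sj] : exists j, (tau + s.+1%:R) / m%:R <= S j j.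
  apply/existsP; apply: contraLR trS => /existsPn Sj; rewrite -ltNge.
  have -> : tau + s.+1%:R = \sum_(i < m) (tau + s.+1%:R) / m%:R.
    by rewrite sumr_const card_ord -[RHS]mulr_natr divfK // gt_eqF.
  apply: ltr_sum => [|i _]; last by rewrite ltNge.
  by apply/hasP; exists (Ordinal m0); rewrite ?mem_index_enum.
pose a := S j j; pose c := col j S.
have a0 : 0 < a by apply: lt_le_trans Sj; rewrite divr_gt0 // ltr_wpDl.
have Sc : S *m c = c by rewrite /c colE mulmxA SS.
have cS : c^T *m S = c^T by rewrite -{1}Ss -trmx_mul Sc.
have cc : c^T *m c = a%:M.
  rewrite [LHS]mx11_scalar; congr _%:M; rewrite /a -[in RHS]SS !mxE.
  by apply: eq_bigr => i _; rewrite !mxE -{1}Ss mxE.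
(* One elimination step: S' is again a projection, with trace smaller by 1, and it kills the basis
   vector [j]. *)
pose S' := S - a^-1 *: (c *m c^T).
have S's : S'^T = S' by rewrite /S' linearB /= linearZ /= trmx_mul trmxK Ss.
have aV : a^-1 * a = 1 by rewrite mulVf // gt_eqF.
have S'S' : S' *m S' = S'.
  have S'c : S' *m c = 0.
    by rewrite mulmxBl Sc -scalemxAl -mulmxA cc mul_mx_scalar scalerA aV scale1r subrr.
  rewrite {2}/S' mulmxBr -scalemxAr mulmxA S'c mul0mx scaler0 subr0.
  by rewrite /S' mulmxBl SS -scalemxAl -mulmxA cS.
have S'e : S' *m delta_mx j (0 : 'I_1) = 0.
  rewrite mulmxBl -scalemxAl -mulmxA -colE -/c.
  have -> : c^T *m delta_mx j 0 = a%:M.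
    by rewrite -colE [LHS]mx11_scalar !mxE.
  by rewrite mul_mx_scalar scalerA aV scale1r subrr.
have trS' : tau + s%:R <= \tr S'.
  rewrite linearB /= mxtraceZ mxtrace_mulC cc mxtrace_scalar mulr1n aV.
  by rewrite lerBrDr -addrA natr1.
have quadS x : quad S x = quad S' x + a^-1 * normsq (c^T *m x).
  rewrite -quad_gram trmxK -quadZ -quadD /S' subrK //.
have a1 : a <= 1.
  rewrite -(ler_pM2l a0) mulr1.
  rewrite [leRHS](_ : a = (S *m S) j j); last by rewrite SS.
  rewrite mxE (bigD1 j) //= lerDl; apply: sumr_ge0 => i _.
  by rewrite -{1}Ss mxE -expr2 sqr_ge0.
(* The grid spacing in units of the Gaussian width: h <= 1 because lambda <= L^2 and a <= 1, while h
   L = sqrt (lambda a) >= theta. *)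
pose h := Num.sqrt (lambda * a) / L%:R.
have L0' : 0 < L%:R :> R by rewrite ltr0n.
have la : 0 < lambda * a by exact: mulr_gt0.
have h0 : 0 < h by rewrite divr_gt0 ?sqrtr_gt0.
have h1 : h <= 1.
  rewrite ler_pdivrMr // mul1r -(ger0_norm (ltW L0')) -sqrtr_sqr ler_sqrt ?exprn_gt0 //.
  by apply: le_trans laL; rewrite ler_piMr // ltW.
have thla' : theta ^+ 2 <= lambda * a.
  rewrite -(ler_pM2r m0') (le_trans thla) // -mulrA ler_pM2l //.
  by rewrite -ler_pdivrMr // (le_trans _ Sj) // ler_pM2r ?invr_gt0 // lerDl.
have hth : theta <= h * L%:R.
  rewrite divfK ?gt_eqF // -[leLHS](ger0_norm (ltW th0)) -sqrtr_sqr.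
  by rewrite ler_sqrt // ltW.
rewrite -(ler_pM2l L0').
(* Coordinate [j] is resampled and summed first, with the others fixed. *)
apply: (@le_trans _ _ (\sum_g \sum_l expR (- (lambda * quad S (grid_vec (upd g j l)))))).
  by rewrite (sum_upd (fun g => expR (- (lambda * quad S (grid_vec g))))) card_ord.
apply: (@le_trans _ _ (\sum_g 7 / h * expR (- (lambda * quad S' (grid_vec g))))).
  apply: ler_sum => g _.
  pose w := grid_vec g - ((g j)%:R / L%:R) *: delta_mx j 0.
  have updE l : grid_vec (upd g j l) = w + (l%:R / L%:R) *: delta_mx j 0.
    apply/colP => i; rewrite !mxE ffunE andbT.
    by have [->|_] := eqVneq i j; rewrite ?mulr1 ?mulr0 ?subr0 ?addr0 // subrr add0r.
  pose b := (c^T *m w) 0 0.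
  (* Completing the square in coordinate [j], on which the [S'] part does not depend. *)
  have quad_upd l : quad S (grid_vec (upd g j l)) =
      quad S' (grid_vec g) + a * (l%:R / L%:R + b / a) ^+ 2.
    rewrite quadS; congr (_ + _).
      have S'v (x : 'cV[R]_m) (t : R) : quad S' (x + t *: delta_mx j 0) = quad S' x.
        have q (y : 'cV[R]_m) : quad S' y = normsq (S' *m y) by rewrite -quad_gram S's S'S'.
        by rewrite !q mulmxDr -scalemxAr S'e scaler0 addr0.
      by rewrite updE S'v -[in RHS](subrK ((g j)%:R / L%:R *: delta_mx j 0) (grid_vec g)) S'v.
    rewrite updE normsqE !big_ord_recl !big_ord0 !addr0.
    have -> : (c^T *m (w + (l%:R / L%:R) *: delta_mx j 0)) 0 0 = b + l%:R / L%:R * a.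
      by rewrite mulmxDr -scalemxAr -colE mxE /b; congr (_ + _); rewrite !mxE.
    by field; rewrite !gt_eqF.
  under eq_bigr => l _.
    rewrite quad_upd mulrDr opprD expRD.
    rewrite (_ : lambda * (a * _) = (h * l%:R + b / a * Num.sqrt (lambda * a)) ^+ 2); last first.
      rewrite mulrA -{1}(sqr_sqrtr (ltW la)) -exprMn /h; congr (_ ^+ 2); ring.
    over.
  by rewrite -mulr_sumr mulrC ler_pM2r ?expR_gt0 // gauss_sum_le // h0.
rewrite -mulr_sumr.
apply: le_trans (_ : 7 * L%:R / theta * ((7 / theta) ^+ s * (L ^ m)%:R) <= _); last first.
  by rewrite exprS le_eqVlt; apply/orP; left; apply/eqP; ring.
apply: ler_pM; rewrite ?divr_ge0 ?(ltW h0) //.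
- by apply: sumr_ge0 => g _; exact: expR_ge0.
- rewrite ler_pdivrMr // mulrAC ler_pdivlMr // -mulrA ler_pM2l // mulrC.
  exact: hth.
- exact: IH.
Qed.

End GridSums.

Section SmallBall.
Context {R : realType}.

Lemma expR1_ge2 : 2 <= expR 1 :> R.
Proof. by apply: le_trans (expR_ge1Dx _); rewrite -[2]/(1 + 1). Qed.

Lemma seven_le_exp3 : 7 <= expR 3 :> R.
Proof.
have -> : expR 3 = expR 1 ^+ 3 :> R by rewrite -expRM_natl mulr1.
by have := expR1_ge2; move: (expR 1) => e e2; rewrite !exprS expr0; nra.
Qed.

Lemma le_expR (x : R) : x <= expR x.
Proof. by apply: le_trans (expR_ge1Dx x); rewrite lerDr. Qed.

(** A Chernoff bound from [sum_gauss_grid], with half of the trace spent on pivots and half kept as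
    reserve. The grid size depends on m, d and K but not on S, so one grid serves all
    projections. *)
Lemma grid_small_ball (m d : nat) (K : R) : (0 < d <= m)%N -> 8 <= K ->
  exists2 L, (0 < L)%N & forall S : 'M[R]_m,
    S^T = S -> S *m S = S -> d.+1%:R <= \tr S ->
    #|[pred g : {ffun 'I_m -> 'I_L} |
        quad S (grid_vec g) <= expR (- (2 * K * (m%:R / d%:R))) * m%:R]|%:R
    <= expR ((8 - K) * m%:R / 2) * (L ^ m)%:R.
Proof.
move=> /andP[d0 dm] K8.
have m0 : (0 < m)%N by exact: leq_trans dm.
have dR : 0 < d%:R :> R by rewrite ltr0n.
have mR : 0 < m%:R :> R by rewrite ltr0n.
pose x : R := m%:R / d%:R.
have x1 : 1 <= x by rewrite ler_pdivlMr // mul1r ler_nat.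
have x0 : 0 < x by exact: lt_le_trans x1.
pose eps := expR (- (2 * K * x)).
have eps0 : 0 < eps by exact: expR_gt0.
(* The Chernoff cost is exp (lambda eps m) = exp (2 d). *)
pose lambda := 2 * d%:R / (eps * m%:R).
have lambda0 : 0 < lambda by rewrite divr_gt0 ?mulr_gt0.
pose L := (Num.truncn lambda).+1.
have lL : lambda <= L%:R by rewrite ltW // truncnS_gt.
have L1 : 1 <= L%:R :> R by rewrite ler1n.
exists L => // S Ss SS trS.
(* This [theta] makes theta^2 m equal to lambda d / 2, the largest value allowed for the reserve d /
   2. *)
pose theta := x^-1 * expR (K * x).
have theta0 : 0 < theta by rewrite mulr_gt0 ?invr_gt0 ?expR_gt0.
have thla : theta ^+ 2 * m%:R <= lambda * (d%:R / 2).
  have -> : theta ^+ 2 = x ^- 2 / eps.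
    by rewrite /theta /eps exprMn exprVn expRN invrK -expRM_natl mulrA.
  rewrite /lambda /x le_eqVlt; apply/orP; left; apply/eqP; field.
  by rewrite !gt_eqF.
(* Rounding d / 2 up still fits, since the trace is at least d + 1. *)
pose s := uphalf d.
have d2s : (d <= 2 * s)%N.
  rewrite /s mul2n uphalf_half doubleD -{1}(odd_double_half d) leq_add2r.
  by case: (odd d).
have taus : d%:R / 2 + s%:R <= \tr S.
  apply: le_trans trS; suff : (2 * s <= d.+1)%N by rewrite -(ler_nat R) natrM -[d.+1%:R]natr1; lra.
  by rewrite mul2n -[leqRHS](odd_double_half d.+1) leq_addl.
have lamL : 0 < lambda <= L%:R ^+ 2.
  by rewrite lambda0 (le_trans lL) // expr2 ler_peMl // (le_trans _ L1).
have d20 : 0 <= d%:R / 2 :> R by rewrite divr_ge0.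
have E := sum_gauss_grid m0 (ltn0Sn _) theta0 d20 lamL thla Ss SS taus.
set B := [pred g | _].
have cB : #|B|%:R <= expR (lambda * (eps * m%:R)) *
    \sum_(g : {ffun 'I_m -> 'I_L}) expR (- (lambda * quad S (grid_vec g))).
  rewrite mulr_sumr -sum1_card natr_sum [leRHS](bigID B) /=; apply: ler_wpDr.
    apply: sumr_ge0 => g _; apply: mulr_ge0; exact: expR_ge0.
  apply: ler_sum => g Bg; rewrite -expRD -[leLHS]expR0 ler_expR -mulrBr.
  by apply: mulr_ge0; [exact: ltW|rewrite subr_ge0; exact: Bg].
apply: le_trans cB _.
have el : lambda * (eps * m%:R) = 2 * d%:R.
  by rewrite /lambda divfK // gt_eqF // mulr_gt0.
rewrite el.
apply: (@le_trans _ _ (expR (2 * d%:R) * ((7 / theta) ^+ s * (L ^ m)%:R))).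
  by rewrite ler_wpM2l ?expR_ge0.
rewrite mulrA ler_wpM2r //.
have th : 7 / theta <= expR (3 + x - K * x).
  rewrite /theta invfM invrK -expRN mulrA expRD expRN ler_wpM2r ?invr_ge0 ?expR_ge0 //.
  rewrite expRD; apply: ler_pM => //; [exact: ltW|exact: seven_le_exp3|exact: le_expR].
have d2s' : d%:R <= 2 * s%:R :> R by rewrite -natrM ler_nat.
apply: (@le_trans _ _ (expR (4 * s%:R) * expR (3 + x - K * x) ^+ s)).
  apply: ler_pM; rewrite ?expR_ge0 ?exprn_ge0 ?divr_ge0 ?(ltW theta0) //.
    by rewrite ler_expR; lra.
  by rewrite lerXn2r // nnegrE ?divr_ge0 ?expR_ge0 ?(ltW theta0).
rewrite -expRM_natl -expRD ler_expR.
(* The exponent on the left is s (7 + x - K x), at most - (K - 8) x s because x >= 1; then 2 s >=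
   d. *)
have -> : m%:R = x * d%:R by rewrite divfK // gt_eqF.
have p1 : (K - 8) * x * d%:R <= (K - 8) * x * (2 * s%:R).
  by rewrite ler_wpM2l // mulr_ge0 ?(ltW x0) // subr_ge0.
have p2 : s%:R * 1 <= s%:R * x by rewrite ler_wpM2l.
lra.
Qed.
End SmallBall.

(** * Gram determinants *)

Section GramDeterminant.
Context {R : rcfType}.

(** For orthonormal columns and k <= r, this is the product of the squared cosines of the principal
    angles between the ranges of W and Y. *)
Definition gram_det m r k (W : 'M[R]_(m, k)) (Y : 'M[R]_(m, r)) : R :=
  \det (W^T *m Y *m (W^T *m Y)^T).

(** For Y with orthonormal columns and a nonzero Gram determinant, the orthogonal projection onto
    the part of range Y that is orthogonal to range U. *)
Definition residual m r k (U : 'M[R]_(m, k)) (Y : 'M[R]_(m, r)) : 'M[R]_m :=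
  let Phi := U^T *m Y in
  Y *m (1%:M - Phi^T *m invmx (Phi *m Phi^T) *m Phi) *m Y^T.

Lemma gram_det_ge0 m r k (W : 'M[R]_(m, k)) (Y : 'M[R]_(m, r)) : 0 <= gram_det W Y.
Proof.
rewrite /gram_det; set Phi := W^T *m Y; set M := Phi *m Phi^T.
have Ms : M^T = M by rewrite /M trmx_mul trmxK.
have [Q [e [QQ ME]]] := symmetric_diagonalization Ms.
rewrite ME !det_mulmx det_diag mulrAC -det_mulmx QQ det1 mul1r.
apply: prodr_ge0 => i _; have [x [_ <-]] := quad_diagonalized e i QQ.
by rewrite -ME /M -{1}[Phi]trmxK quad_gram normsq_ge0.
Qed.

Lemma gram_det_mull m r k (W : 'M[R]_(m, k)) (Q : 'M[R]_m) (Y : 'M[R]_(m, r)) :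
  gram_det W (Q *m Y) = gram_det (Q^T *m W) Y.
Proof. by rewrite /gram_det (trmx_mul Q^T) trmxK mulmxA. Qed.

Lemma det_schur (n1 n2 : nat) (a : 'M[R]_n1) (b : 'M[R]_(n1, n2)) c (M : 'M[R]_n2) :
  M \in unitmx -> \det (block_mx a b c M) = \det M * \det (a - b *m invmx M *m c).
Proof.
move=> Mu; have -> : block_mx a b c M =
    block_mx 1%:M (b *m invmx M) 0 1%:M *m block_mx (a - b *m invmx M *m c) 0 c M.
  rewrite mulmx_block !(mul1mx, mul0mx, mulmx0, add0r, subrK).
  by rewrite -mulmxA mulVmx // mulmx1.
by rewrite det_mulmx det_ublock det_lblock !det1 !mul1r mulrC.
Qed.

(* [quad (residual U Y) u] is the Schur complement of the Gram matrix of U. *)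
Lemma gram_det_cons m r k (u : 'cV[R]_m) (U : 'M[R]_(m, k)) (Y : 'M[R]_(m, r)) :
  gram_det U Y != 0 ->
  gram_det (row_mx u U) Y = gram_det U Y * quad (residual U Y) u.
Proof.
rewrite /gram_det => M0; set Phi := U^T *m Y in M0 *; set M := Phi *m Phi^T in M0 *.
have Mu : M \in unitmx by rewrite unitmxE unitfE.
rewrite tr_row_mx mul_col_mx -/Phi tr_col_mx mul_col_row det_schur //.
congr (_ * _); rewrite det_mx11 /quad /residual -/Phi -/M.
have e (N : 'M[R]_1) : N 0 0 = \tr N by rewrite /mxtrace big_ord_recl big_ord0 addr0.
rewrite e; congr (\tr _).
clearbody M Phi; rewrite trmx_mul trmxK !mulmxA [X in _ = X *m _ *m _]mulmxBr.
by rewrite mulmx1 !mulmxBl !mulmxA.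
Qed.

(** Phi^T M^-1 Phi projects onto the row space of Phi, of dimension k, and the isometry Y transports
    the complementary projection. *)
Lemma residualP m r k (U : 'M[R]_(m, k)) (Y : 'M[R]_(m, r)) :
  Y^T *m Y = 1%:M -> gram_det U Y != 0 ->
  [/\ (residual U Y)^T = residual U Y, residual U Y *m residual U Y = residual U Y,
      \tr (residual U Y) = r%:R - k%:R & residual U Y *m U = 0].
Proof.
rewrite /gram_det /residual => YY; set Phi := U^T *m Y; set M := Phi *m Phi^T => M0.
have Mu : M \in unitmx by rewrite unitmxE unitfE.
have Ms : M^T = M by rewrite /M trmx_mul trmxK.
set Pi := Phi^T *m invmx M *m Phi; pose P := 1%:M - Pi.
have PiPhi : Pi *m Phi^T = Phi^T by rewrite /Pi -(mulmxA _ Phi) -/M -mulmxA mulVmx // mulmx1.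
have PPhi : P *m Phi^T = 0 by rewrite mulmxBl mul1mx PiPhi subrr.
have Pis : Pi^T = Pi.
  by rewrite /Pi (trmx_mul _ Phi) (trmx_mul Phi^T) trmxK trmx_inv Ms mulmxA.
have Ps : P^T = P by rewrite /P linearB /= trmx1 Pis.
have PP : P *m P = P.
  by rewrite {2}/P mulmxBr mulmx1 /Pi -(mulmxA Phi^T) (mulmxA P) PPhi mul0mx subr0.
rewrite -/P; split.
- by rewrite !trmx_mul trmxK Ps mulmxA.
- by rewrite !mulmxA -(mulmxA _ Y^T) YY mulmx1 -(mulmxA Y) PP.
- rewrite -mulmxA mxtrace_mulC -mulmxA YY mulmx1 /P linearB /= mxtrace1.
  by rewrite /Pi mxtrace_mulC (mulmxA Phi) -/M mulmxV // mxtrace1.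
- have YU : Y^T *m U = Phi^T by rewrite /Phi trmx_mul trmxK.
  by rewrite -(mulmxA _ Y^T) YU -(mulmxA Y) PPhi mulmx0.
Qed.

(** Let v be the component of g orthogonal to range U. The reflection swapping u and v / |v| fixes
    U, as both vectors are orthogonal to it; if v = 0, the identity and c = 0 work. *)
Lemma direction_reflection m k (U : 'M[R]_(m, k)) (u g : 'cV[R]_m) :
  U^T *m U = 1%:M -> normsq u = 1 -> U^T *m u = 0 ->
  exists (Q : 'M[R]_m) (c : R),
    [/\ Q^T = Q, Q^T *m Q = 1%:M, Q *m U = U,
        g - U *m (U^T *m g) = c *: (Q *m u) & c ^+ 2 <= normsq g].
Proof.
move=> UU u1 Uu; set v := g - _.
have Uv : U^T *m v = 0 by rewrite mulmxBr !mulmxA UU mul1mx subrr.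
have vg : normsq v <= normsq g by rewrite [leRHS](stiefel_contract g UU) lerDr normsq_ge0.
have [v0|v0] := eqVneq v 0.
  exists 1%:M, 0; rewrite trmx1 mulmx1 mul1mx v0 scale0r expr0n /= normsq_ge0; split=> //.
pose c := Num.sqrt (normsq v).
have c2 : c ^+ 2 = normsq v by rewrite sqr_sqrtr // normsq_ge0.
have c0 : c != 0.
  by apply: contra v0 => /eqP c0; apply/eqP/normsq_eq0; rewrite -c2 c0 expr0n.
pose q := c^-1 *: v.
have q1 : normsq q = 1 by rewrite normsqZ -c2 exprVn mulVf // expf_neq0.
have [Q [Qs QQ Qu Qfix]] := swap_reflection u1 q1.
exists Q, c; split => //; last by rewrite c2.
- apply: Qfix; first by rewrite -[U]trmxK -trmx_mul Uu trmx0.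
  by rewrite -[U]trmxK -trmx_mul /q -scalemxAr Uv scaler0 trmx0.
- by rewrite Qu /q scalerA divff // scale1r.
Qed.

(** The residual kills range U, so its form at g is c^2 times its form at Q u, and the latter is the
    ratio of the two Gram determinants at Q Y. *)
Lemma residual_small_quad m r k (U : 'M[R]_(m, k)) (u : 'cV[R]_m) (Y : 'M[R]_(m, r))
    (Q : 'M[R]_m) (g : 'cV[R]_m) c eps :
  Y^T *m Y = 1%:M -> Q^T = Q -> Q *m U = U ->
  g - U *m (U^T *m g) = c *: (Q *m u) -> c ^+ 2 <= normsq g -> 0 <= eps ->
  gram_det (row_mx u U) (Q *m Y) < eps * gram_det U (Q *m Y) ->
  gram_det U Y != 0 /\ quad (residual U Y) g <= eps * normsq g.
Proof.
move=> YY Qs QU gE cg eps0; rewrite !gram_det_mull Qs QU mul_mx_row QU => lt.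
(* A zero determinant would contradict the strict inequality. *)
have M0 : gram_det U Y != 0.
  by apply: contraTneq lt => ->; rewrite mulr0 -leNgt gram_det_ge0.
have [Ss SS _ SU] := residualP YY M0; split=> //.
have quadE (x : 'cV[R]_m) : quad (residual U Y) x = normsq (residual U Y *m x).
  by rewrite -quad_gram Ss SS.
have -> : quad (residual U Y) g = c ^+ 2 * quad (residual U Y) (Q *m u).
  rewrite !quadE -normsqZ scalemxAr -gE mulmxBr (mulmxA _ U) SU mul0mx subr0 //.
rewrite mulrC; apply: ler_pM; rewrite ?sqr_ge0 // ?quadE ?normsq_ge0 // -quadE.
move: lt; rewrite gram_det_cons // mulrC ltr_pM2r; first exact: ltW.
by rewrite lt0r M0 gram_det_ge0.
Qed.

End GramDeterminant.

(** * The uniform measure on the Stiefel manifold *)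

Section Continuity.
Context {R : realType} {T : topologicalType}.

Lemma sum_continuous (I : Type) (s : seq I) (F : I -> T -> R) :
  (forall i, continuous (F i)) -> continuous (fun x => \sum_(i <- s) F i x).
Proof.
move=> Fc; elim: s => [|i s IH] x.
  by under eq_fun do rewrite big_nil; exact: cvg_cst.
by under eq_fun do rewrite big_cons; apply: cvgD; [exact: Fc|exact: IH].
Qed.

Lemma prod_continuous (I : Type) (s : seq I) (F : I -> T -> R) :
  (forall i, continuous (F i)) -> continuous (fun x => \prod_(i <- s) F i x).
Proof.
move=> Fc; elim: s => [|i s IH] x.
  by under eq_fun do rewrite big_nil; exact: cvg_cst.
by under eq_fun do rewrite big_cons; apply: cvgM; [exact: Fc|exact: IH].
Qed.

Lemma det_continuous n (F : T -> 'M[R]_n) :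
  (forall i j, continuous (fun x => F x i j)) -> continuous (fun x => \det (F x)).
Proof.
move=> Fc; rewrite /determinant; apply: sum_continuous => s x.
apply: cvgM; first exact: cvg_cst.
by apply: prod_continuous => i; exact: Fc.
Qed.

End Continuity.

Section StiefelMeasure.
Context {R : realType}.

(* For the m x 0 matrix U, whose Gram determinant is 1, these are the sublevel
   sets of [gram_det W]. *)
Definition gram_drop m r k l (W : 'M[R]_(m, l)) (U : 'M[R]_(m, k)) (e : R) :=
  [set Y : 'M[R]_(m, r) | gram_det W Y < e * gram_det U Y].

Lemma gram_det_continuous m r k (W : 'M[R]_(m, k)) :
  continuous (gram_det W : 'M[R]_(m, r) -> R).
Proof.
have phi_c a b : continuous (fun Y : 'M[R]_(m, r) => (W^T *m Y) a b).
  under eq_fun do rewrite mxE.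
  apply: sum_continuous => i x.
  exact: (cvgM (cvg_cst _) (@coord_continuous _ _ _ i b x)).
apply: det_continuous => a b; under eq_fun do rewrite mxE.
apply: sum_continuous => i x; under eq_fun do rewrite [X in _ * X]mxE.
exact: (cvgM (phi_c a i x) (phi_c b i x)).
Qed.

Lemma gram_drop_borel m r k l (W : 'M[R]_(m, l)) (U : 'M[R]_(m, k)) e :
  borel_mx m r (gram_drop W U e).
Proof.
apply: sub_sigma_algebra => /=.
pose f (Y : 'M[R]_(m, r)) : R := gram_det W Y - e * gram_det U Y.
have -> : gram_drop W U e = f @^-1` [set x | x < 0].
  by apply/seteqP; split => Y; rewrite /gram_drop /f /= subr_lt0.
apply: open_comp; last exact: open_lt.
move=> Y _; apply: (cvgB (@gram_det_continuous _ _ _ W Y)).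
exact: (cvgM (cvg_cst _) (@gram_det_continuous _ _ _ U Y)).
Qed.

(** The sum of the probabilities is the expected number of events that occur. *)
Lemma average_measure (d : measure_display) (T : measurableType d) (P : probability T R)
    (G : finType) (E : G -> set T) (c : R) :
  (forall g, measurable (E g)) -> (forall w, \sum_g \1_(E g) w <= c) ->
  (\sum_g P (E g) <= c%:E)%E.
Proof.
move=> mE Ec.
have -> : (\sum_g P (E g))%E = (\sum_g \int[P]_w (\1_(E g) w)%:E)%E.
  by apply: eq_bigr => g _; rewrite integral_indic // setIT.
rewrite -ge0_integral_sum //; first last.
  by move=> g; apply/measurable_EFinP; exact: measurable_indic.
apply: (@le_trans _ _ (\int[P]_w (cst c%:E) w)%E).
  apply: ge0_le_integral => //.
  - by move=> w _; apply: sume_ge0 => g _; rewrite lee_fin.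
  - by apply: emeasurable_sum => g; apply/measurable_EFinP; exact: measurable_indic.
  - by move=> w _; rewrite sumEFin lee_fin.
have PT : P setT = 1%E := probability_setT P.
rewrite integral_cst // -[leRHS]mule1 -PT.
exact: lexx.
Qed.

End StiefelMeasure.

Section UniformStiefel.
Context {R : realType} (d : measure_display) (T : measurableType d).
Context (P : probability T R) (m r : nat) (X : T -> 'M[R]_(m, r)).
Hypothesis Xu : uniform_on_stiefel P X.
Variables (n : nat) (K : R).
Hypothesis n_bounds : (0 < n <= m)%N.
Hypothesis K8 : 8 <= K.

Let eps := expR (- (2 * K * (m%:R / n%:R))).
Let p1 := expR ((8 - K) * m%:R / 2).

Lemma gram_drop_measurable k l (W : 'M[R]_(m, l)) (U : 'M[R]_(m, k)) e :
  measurable (X @^-1` gram_drop W U e).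
Proof. by have [_ mX _] := Xu; apply: mX; exact: gram_drop_borel. Qed.

(** By invariance each reflected event [E g] is as likely as the original one. At a fixed outcome,
    [E g] makes the residual form small at [grid_vec g], which happens for few grid points;
    averaging over g concludes. *)
Lemma gram_drop_prob k (U : 'M[R]_(m, k)) (u : 'cV[R]_m) :
  (k + n < r)%N -> U^T *m U = 1%:M -> normsq u = 1 -> U^T *m u = 0 ->
  (P (X @^-1` gram_drop (row_mx u U) U eps) <= p1%:E)%E.
Proof.
move=> knr UU u1 Uu; have [XS _ Xinv] := Xu.
have [L L0 small] := grid_small_ball n_bounds K8.
have [Q HQ] := choice (fun g : {ffun 'I_m -> 'I_L} =>
  direction_reflection (grid_vec g : 'cV[R]_m) UU u1 Uu).
set B := gram_drop _ _ _.
pose E g := (fun w => Q g *m X w) @^-1` B.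
have EE g : E g = X @^-1` gram_drop ((Q g)^T *m row_mx u U) ((Q g)^T *m U) eps.
  by apply/seteqP; split => w; rewrite /E /B /gram_drop /= !gram_det_mull.
have mE g : measurable (E g) by rewrite EE; exact: gram_drop_measurable.
have PE g : P (E g) = P (X @^-1` B).
  by have [c [_ QQ _ _ _]] := HQ g; apply: Xinv => //; exact: gram_drop_borel.
have eps0 : 0 <= eps by exact: expR_ge0.
have sumE w : \sum_g \1_(E g) w <= p1 * (L ^ m)%:R.
  have YY : (X w)^T *m X w = 1%:M by exact: XS.
  have bad g : E g w -> gram_det U (X w) != 0 /\
      quad (residual U (X w)) (grid_vec g) <= eps * m%:R.
    have [c [Qs QQ QU gE cg]] := HQ g => Egw.
    have [-> /le_trans le] := residual_small_quad YY Qs QU gE cg eps0 Egw.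
    by split=> //; apply: le; rewrite ler_wpM2l ?normsq_grid_vec.
  have [M0|M0] := eqVneq (gram_det U (X w)) 0.
    rewrite big1 ?mulr_ge0 ?expR_ge0 // => g _; rewrite indicE.
    by rewrite memNset // => /bad []; rewrite M0 eqxx.
  have [Ss SS trS _] := residualP YY M0.
  (* The strict inequality k + n < r supplies the extra 1 in the trace. *)
  have trn : n.+1%:R <= \tr (residual U (X w)).
    by rewrite trS lerBrDr -natrD ler_nat addSn addnC.
  apply: le_trans (small _ Ss SS trn).
  rewrite -sum1_card natr_sum [leRHS]big_mkcond /=; apply: ler_sum => g _.
  rewrite indicE; have [/bad [_ q]|nE] := pselect (E g w).
    by rewrite ifT; [case: (_ \in _)|exact: q].
  by rewrite memNset //; case: ifP.
have := average_measure P mE sumE.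
rewrite (eq_bigr (fun=> P (X @^-1` B))) //.
have fP : P (X @^-1` B) \is a fin_num by apply: fin_num_measure; exact: gram_drop_measurable.
rewrite -(fineK fP) sumEFin !lee_fin sumr_const card_ffun !card_ord -[leLHS]mulr_natr.
by rewrite ler_pM2r // ltr0n expn_gt0 L0.
Qed.

(** A union bound over the columns: if the determinant is below eps^(k+1), then either that of the
    last k columns is below eps^k or adding the first column shrinks it by more than eps. *)
Lemma gram_det_prob k (U : 'M[R]_(m, k)) : (k + n <= r)%N -> U^T *m U = 1%:M ->
  (P (X @^-1` gram_drop U (0 : 'M[R]_(m, 0)) (eps ^+ k)) <= (k%:R * p1)%:E)%E.
Proof.
have det0 (Y : 'M[R]_(m, r)) : gram_det (0 : 'M[R]_(m, 0)) Y = 1 by exact: det_mx00.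
elim: k => [|k IH] in U *.
  move=> _ _; rewrite mul0r [X in P X](_ : _ = set0) ?measure0 //.
  apply/seteqP; split => w //; rewrite /gram_drop /= det0 mulr1 expr0.
  by rewrite [gram_det _ _]det_mx00 ltxx.
move=> knr; move: U; rewrite -[k.+1]/(1 + k)%N => U UU.
pose u := lsubmx U; pose V := rsubmx U.
have UE : U = row_mx u V by rewrite hsubmxK.
have [uu uV Vu VV] : [/\ u^T *m u = 1%:M, u^T *m V = 0, V^T *m u = 0 & V^T *m V = 1%:M].
  move: UU; rewrite UE tr_row_mx mul_col_row -[RHS]submxK.
  by rewrite scalar_mx_block block_mxKul block_mxKur block_mxKdl block_mxKdr => /eq_block_mx.
have u1 : normsq u = 1 by rewrite /normsq uu mxtrace1.
have step := gram_drop_prob knr VV u1 Vu.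
have IHV := IH V (ltnW knr) VV.
apply: (@le_trans _ _ (P (X @^-1` gram_drop V (0 : 'M[R]_(m, 0)) (eps ^+ k) `|`
                          X @^-1` gram_drop (row_mx u V) V eps))).
  apply: le_measure; rewrite ?inE.
  - exact: gram_drop_measurable.
  - by apply: measurableU; exact: gram_drop_measurable.
  move=> w; rewrite /gram_drop /= !det0 !mulr1 -UE => lt.
  have [|le] := ltP (gram_det V (X w)) (eps ^+ k); first by left.
  right; apply: lt_le_trans lt _; rewrite exprS ler_pM2l //.
  exact: expR_gt0.
apply: le_trans (measureU2 _ _ _) _; [exact: gram_drop_measurable..|].
by rewrite -natr1 mulrDl mul1r EFinD leeD.
Qed.

End UniformStiefel.

(** * Number of iterations and conclusion *)

(** In the application N = m r r_A / (r - r_A)^2 and N1 = r_A m / (r - r_A), and exp ((2 K + 1) N1)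
    bounds the initial squared tangent. *)
Lemma iteration_count (R : realType) (N N1 kappa eta c1 K eps : R) :
  1 <= N -> 0 <= N1 <= N -> 1 < kappa -> 0 < c1 -> 0 <= K ->
  c1 / (N * kappa) <= eta -> eta < 1 -> 0 < eps < 1 ->
  exists t : nat,
    t%:R <= ((2 * K + 1) / c1 + 1 / c1 + 1) *
            (kappa ^+ 2 * N ^+ 2 + kappa ^+ 2 * N * ln (1 / eps)) /\
    (1 + eta / kappa) ^- (2 * t) * expR ((2 * K + 1) * N1) / 2 <= eps.
Proof.
move=> N_1 /andP[N10 N1N] kappa1 c10 K0 c1eta eta1 /andP[eps0 eps1].
have N0 : 0 < N by lra.
have kappa0 : 0 < kappa by lra.
have eta0 : 0 < eta by apply: lt_le_trans c1eta; rewrite divr_gt0 ?mulr_gt0.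
pose y := eta / kappa; pose l := ln (1 / eps).
have y0 : 0 < y by rewrite divr_gt0.
have y1 : y < 1 by rewrite ltr_pdivrMr ?mul1r // (lt_trans eta1).
have yp : 0 < 1 + y by lra.
have l0 : 0 <= l by rewrite ln_ge0 // ler_pdivlMr // mul1r ltW.
(* Contraction by exp (- y) per iteration reaches eps once y t >= (2 K + 1) N1 + ln (1 / eps). *)
pose z := ((2 * K + 1) * N1 + l) / y.
have z0 : 0 <= z.
  by rewrite divr_ge0 ?(ltW y0) // addr_ge0 // mulr_ge0 // addr_ge0 // mulr_ge0.
exists (Num.truncn z).+1; split; last first.
  have zt : z <= (Num.truncn z).+1%:R by rewrite ltW // truncnS_gt.
  move: (Num.truncn z).+1 zt => t zt.
  (* For y <= 1, (1 + y)^-1 <= 1 - y / 2 <= exp (- y / 2). *)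
  have ey : (1 + y)^-1 <= expR (- (y / 2)).
    apply: le_trans (expR_ge1Dx _); rewrite -[leLHS]mul1r ler_pdivrMr //.
    by nra.
  have eyt : (1 + y) ^- (2 * t) <= expR (- (y * t%:R)).
    rewrite -exprVn; apply: (@le_trans _ _ (expR (- (y / 2)) ^+ (2 * t))).
      by rewrite lerXn2r // nnegrE ?expR_ge0 // invr_ge0; lra.
    by rewrite -expRM_natl ler_expR natrM; lra.
  apply: (@le_trans _ _ (expR (- (y * t%:R)) * expR ((2 * K + 1) * N1) / 2)).
    by rewrite ler_wpM2r // ler_wpM2r ?expR_ge0.
  have : y * z <= y * t%:R by rewrite ler_wpM2l // ltW.
  rewrite {1}/z mulrC divfK ?gt_eqF // => yt.
  rewrite -expRD; apply: (@le_trans _ _ (expR (- l) / 2)).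
    by rewrite ler_wpM2r // ler_expR addrC lerBlDl lerBrDr.
  have -> : expR (- l) = eps.
    by rewrite /l div1r lnV ?posrE // opprK lnK.
  by rewrite ler_pdivrMr // ler_peMr ?ler1n // ltW.
have tz : (Num.truncn z).+1%:R <= z + 1 by rewrite -natr1 lerD2r truncn_le.
apply: le_trans tz _.
have yV : y^-1 <= kappa ^+ 2 * N / c1.
  rewrite /y invf_div ler_pdivrMr //.
  move: c1eta; rewrite ler_pdivrMr ?mulr_gt0 // => c1eta.
  have : kappa * c1 <= kappa * (eta * (N * kappa)) by rewrite ler_wpM2l // ltW.
  rewrite -ler_pdivlMr // => /le_trans; apply.
  by rewrite le_eqVlt; apply/orP; left; apply/eqP; field; rewrite gt_eqF.
pose q := kappa ^+ 2 * N.
have q1 : 1 <= q.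
  by rewrite /q -[1]mulr1 ler_pM // exprn_ege1 // ltW.
have -> : kappa ^+ 2 * N ^+ 2 = q * N by rewrite /q; ring.
rewrite -/q -/l in yV *.
have zq : z <= ((2 * K + 1) * N + l) * (q / c1).
  apply: ler_pM => //; rewrite ?invr_ge0 ?(ltW y0) ?addr_ge0 ?mulr_ge0 //; try lra.
  by rewrite lerD2r ler_wpM2l //; lra.
(* This absorbs the 1 added when rounding [z] up. *)
have qN : 1 <= q * N by rewrite -[1]mulr1 ler_pM.
have ql : 0 <= q * l by rewrite mulr_ge0 //; lra.
have qc : 0 <= q / c1 by rewrite divr_ge0 ?(ltW c10) //; lra.
have c1V : 0 <= c1^-1 by rewrite invr_ge0 ltW.
have e : ((2 * K + 1) / c1 + 1 / c1 + 1) * (q * N + q * l) =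
  ((2 * K + 1) * N + l) * (q / c1) + 2 * K * c1^-1 * (q * l) + c1^-1 * (q * l) +
  c1^-1 * (q * N) + q * N + q * l by field; rewrite gt_eqF.
rewrite e.
have h1 : 0 <= 2 * K * c1^-1 * (q * l).
  by rewrite mulr_ge0 // mulr_ge0 // mulr_ge0.
have h2 : 0 <= c1^-1 * (q * l) by rewrite mulr_ge0.
have h3 : 0 <= c1^-1 * (q * N) by rewrite mulr_ge0 //; lra.
lra.
Qed.

Lemma stiefel_leq (R : fieldType) m r (X : 'M[R]_(m, r)) : X^T *m X = 1%:M -> (r <= m)%N.
Proof.
move=> XX; rewrite -(mxrank1 R r) -XX.
by apply: leq_trans (mxrankM_maxr _ _) _; exact: rank_leq_row.
Qed.

Theorem theorem1 (R : realType) :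
  exists c0 : R, 0 < c0 /\
  forall c1 delta : R, 0 < c1 <= c0 -> 0 < delta < 1 ->
  exists (C : R) (p : nat -> R),
  [/\ 0 < C, forall m, p m <= delta, p m @[m --> \oo] --> (0 : R) &
  forall (m r rA : nat) (kappa : R) (A : 'M[R]_m),
    psd_sym A ->
    \rank A = rA ->
    largest_singular_value A 1 ->
    smallest_nonzero_singular_value A kappa^-1 ->
    1 < kappa ->
    (rA < r)%N ->
    rA%:R <= m%:R / 2%:R :> R ->
  forall eta : R,
    c1 * ((r%:R - rA%:R) ^+ 2 / (m%:R * r%:R * rA%:R * kappa)) <= eta ->
    eta <= c0 * ((r%:R - rA%:R) ^+ 2 / (m%:R * r%:R * rA%:R * kappa)) ->
  forall (d : measure_display) (T : measurableType d) (P : probability T R)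
    (X0 : T -> 'M[R]_(m, r)) (Theta_init : 'M[R]_r),
    uniform_on_stiefel P X0 ->
    Theta_init^T = Theta_init ->
  exists E : set T,
  [/\ measurable E,
      ((1 - p m)%:E <= P E)%E &
      forall w, E w ->
      forall eps : R, 0 < eps < 1 ->
      exists t : nat,
        t%:R <= C * (m%:R ^+ 2 * r%:R ^+ 2 * rA%:R ^+ 2 * kappa ^+ 2
                       / (r%:R - rA%:R) ^+ 4
                     + m%:R * r%:R * rA%:R * kappa ^+ 2
                       / (r%:R - rA%:R) ^+ 2 * ln (1 / eps)) /\
        objective A (dmd_X A eta (X0 w) t)
          (dmd_Theta A eta 2%:R (X0 w) Theta_init t) <= eps]].
Proof.
(* Since N kappa >= 1, a stepsize of at most 1 / (2 N kappa) is below 1. *)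
exists (1 / 2); split=> [|c1 delta /andP[c10 c1le] /andP[delta0 delta1]].
  by rewrite divr_gt0.
(* With this [K], exp (m) exp ((8 - K) m / 2) = delta^(2 m), which is at most delta^(m + 1) for m >=
   1. *)
pose K := 10 - 4 * ln delta.
have lndelta : ln delta < 0 by rewrite ln_lt0 // delta0.
have K8 : 8 <= K by rewrite /K; lra.
have K0 : 0 <= K by lra.
exists ((2 * K + 1) / c1 + 1 / c1 + 1), (fun m => delta ^+ m.+1); split.
- have c1V : 0 < c1^-1 by rewrite invr_gt0.
  have : 0 <= (2 * K + 1) / c1 by rewrite divr_ge0 ?(ltW c10) //; lra.
  by rewrite div1r; lra.
- by move=> m; rewrite exprS ler_piMr ?(ltW delta0) // exprn_ile1 // ltW.
- rewrite (cvg_shiftS (fun m => delta ^+ m)); apply: cvg_expr.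
  by rewrite ger0_norm // ltW.
move=> m r rA kappa A Apsd rkA large small kappa1 rAr _ eta eta_lo eta_hi.
move=> d T P X0 Theta Xu _.
have kappa0 : 0 < kappa by lra.
have [k [U [a [rkA' k0 UU AE ab]]]] := psd_factorization kappa0 Apsd large small.
move: rkA; rewrite rkA' => krA; subst rA.
(* The sample space has mass 1, so it has a point, and the value of [X0] there gives r <= m. *)
have [w0 _] : [set: T] !=set0.
  apply/set0P/eqP => T0; have := probability_setT P; rewrite T0 measure0 => /eqP.
  by rewrite eqe eq_sym oner_eq0.
have [XS _ _] := Xu.
have rm : (r <= m)%N by exact: stiefel_leq (XS w0).
pose n := (r - k)%N.
have n0 : (0 < n)%N by rewrite subn_gt0.
have nm : (0 < n <= m)%N by rewrite n0 (leq_trans (leq_subr _ _)).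
have knr : (k + n <= r)%N by rewrite subnKC // ltnW.
have nE : r%:R - k%:R = n%:R :> R by rewrite natrB // ltnW.
have m0 : (0 < m)%N by case/andP: nm => _; exact: leq_trans.
have [nR [rR [mR kR]]] : 0 < n%:R :> R /\ 0 < r%:R :> R /\ 0 < m%:R :> R /\ 0 < k%:R :> R.
  by rewrite !ltr0n n0 m0 k0 (leq_ltn_trans _ rAr).
pose theta := expR (- (2 * K * (m%:R / n%:R))) ^+ k.
pose bad := X0 @^-1` gram_drop U (0 : 'M[R]_(m, 0)) theta.
have mbad : measurable bad by exact: (gram_drop_measurable Xu).
exists (~` bad); split.
- exact: measurableC.
- rewrite probability_setC // EFinB leeB //.
  apply: le_trans (gram_det_prob Xu nm K8 knr UU) _; rewrite lee_fin.
  (* The factor k of the union bound is at most m <= exp m. *)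
  apply: (@le_trans _ _ (expR (m%:R) * expR ((8 - K) * m%:R / 2))).
    rewrite ler_wpM2r ?expR_ge0 // (le_trans _ (le_expR _)) // ler_nat.
    by rewrite (leq_trans (ltnW rAr)).
  rewrite -expRD -[delta in leRHS]lnK ?posrE // -expRM_natl ler_expR /K.
  have m1 : 1 <= m%:R :> R by rewrite ler1n.
  have : ln delta * m%:R <= ln delta * 1 by rewrite ler_nM2l.
  by rewrite -natr1; lra.
move=> w good eps eps01.
pose N : R := m%:R * r%:R * k%:R / n%:R ^+ 2.
pose N1 : R := k%:R * (m%:R / n%:R).
have nr : n%:R <= r%:R :> R by rewrite ler_nat leq_subr.
have k1 : 1 <= k%:R :> R by rewrite ler1n.
have nm' : n%:R <= m%:R :> R by rewrite ler_nat; case/andP: nm.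
have mn1 : 1 <= m%:R / n%:R :> R by rewrite ler_pdivlMr // mul1r.
have NE : N = N1 * (r%:R / n%:R) by rewrite /N /N1; field; rewrite gt_eqF.
have N1k : k%:R <= N1 by rewrite ler_peMr // ltW.
have N1N : N1 <= N by rewrite NE ler_peMr ?ler_pdivlMr ?mul1r //; lra.
have N_1 : 1 <= N by lra.
have etaE c : c * (n%:R ^+ 2 / (m%:R * r%:R * k%:R * kappa)) = c / (N * kappa).
  by rewrite /N; field; rewrite !gt_eqF.
move: eta_lo eta_hi; rewrite !nE !etaE => eta_lo eta_hi.
have Nk1 : 1 <= N * kappa by rewrite -[1]mulr1 ler_pM // ltW.
have eta1 : eta < 1.
  apply: le_lt_trans eta_hi _; rewrite ltr_pdivrMr ?(lt_le_trans _ Nk1) //; lra.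
have eta0 : 0 < eta.
  by apply: lt_le_trans eta_lo; rewrite divr_gt0 // (lt_le_trans _ Nk1).
have N1b : 0 <= N1 <= N by rewrite N1N andbT; lra.
have [t [tC tE]] := iteration_count N_1 N1b kappa1 c10 K0 eta_lo eta1 eps01.
exists t; split.
  suff [-> ->] : m%:R ^+ 2 * r%:R ^+ 2 * k%:R ^+ 2 * kappa ^+ 2 / n%:R ^+ 4 =
                   kappa ^+ 2 * N ^+ 2 /\
                 m%:R * r%:R * k%:R * kappa ^+ 2 / n%:R ^+ 2 = kappa ^+ 2 * N.
    exact: tC.
  have n4 : n%:R ^+ 4 = (n%:R ^+ 2) ^+ 2 :> R by rewrite -exprM.
  by split; rewrite ?n4 /N; field; rewrite gt_eqF.
have theta0 : 0 < theta by rewrite exprn_gt0 // expR_gt0.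
have det_w : theta <= gram_det U (X0 w).
  rewrite leNgt; apply/negP => lt; apply: good.
  by rewrite /bad /gram_drop /= [gram_det 0 _]det_mx00 mulr1.
have al := aligned_init (XS w) UU theta0 det_w.
have eta01 : 0 < eta < 1 by rewrite eta0.
rewrite AE; apply: le_trans (dmd_objective UU kappa1 ab eta01 _ _ al) _.
apply: le_trans tE; rewrite ler_wpM2r //; apply: ler_wpM2l.
  by rewrite invr_ge0 exprn_ge0 // addr_ge0 // divr_ge0 ?(ltW eta0) ?(ltW kappa0).
(* The initial bound is k / theta = k exp (2 K N1), and k <= N1 <= exp N1. *)
rewrite mulrDl mul1r expRD /theta -expRM_natl mulrN expRN invrK mulrC.
rewrite (_ : k%:R * _ = 2 * K * N1); last by rewrite /N1; ring.
by rewrite ler_wpM2l ?expR_ge0 // (le_trans N1k) // le_expR.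
Qed.
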